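(* Let $\Omega$ be a star graph with outer paths $\Omega_1,\ldots,\Omega_N$ $(N\ge2)$, and assume that $$F(1)+\big((N-1)^2-1\big)F(a)>0.$$ Let $\Omega'$ be a graph obtained by replacing the center point $\mathrm P$ of $\Omega$ by a bounded finite graph $D$; all edges have the same thickness. Then complete invasion occurs, that is, $\widehat v_i\equiv1$ on $\Omega'$ for every $i\in\{1,\ldots,N\}$, where $\widehat v_i$ is the limit profile on $\Omega'$ associated with its $i$-th outer path, if the total length of the edges of the center graph $D$ is sufficiently small.
   Context: Metric graphs: a metric graph is a connected graph each of whose edges $E$ is identified with an interval $[0,L_E]$ (finite length $L_E>0$) or $[0,\infty)$ (infinite length); directions of edges only serve to fix coordinates. Multiple edges, loops and vertices of degree $1$ are allowed. All edges have the same thickness (weight). At a vertex $V$ with incident edges $E_1,\ldots,E_m$ (a loop is counted twice), $\frac{\partial u}{\partial\nu_k}(V)$ denotes the derivative of $u$ at $V$ along $E_k$ in the direction pointing from $V$ into the interior of $E_k$; the Kirchhoff condition at $V$ is $\sum_{k=1}^m\frac{\partial u}{\partial\nu_k}(V)=0$. Star graph: $N$ half lines $\Omega_1,\dots,\Omega_N$ (outer paths), with coordinates $x_i\in[0,\infty)$, whose endpoints $x_i=0$ are identified with a single vertex $\mathrm P$. Replacing $\mathrm P$ by a bounded finite metric graph $D$ (finitely many edges of finite length) gives $\Omega'=D\cup\Omega_1'\cup\cdots\cup\Omega_N'$, where $\Omega_i'$ is a half line with coordinate $x_i\in[0,\infty)$, with $D\cap\Omega_i'=\{\mathrm P_i\}$,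 where $\mathrm P_i$ (corresponding to $x_i=0$) is a vertex of $D$; the $\mathrm P_i$ are not necessarily distinct. Nonlinearity: $f\in C^1$ and for some $0<a<1$: $f(0)=f(a)=f(1)=0$, $f<0$ on $(0,a)$, $f>0$ on $(a,1)$, $f'(0)<0$, $f'(a)>0$, $f'(1)<0$, $\int_0^1f(s)\,ds>0$. $F(s)=\int_0^sf(r)\,dr$. Solution of $\partial_tu=\Delta_{\Omega'}u+f(u)$ on a time interval: a function $u(t,x)$ continuous in $(t,x)$ that satisfies $\partial_tu=\partial_x^2u+f(u)$ on each edge except at endpoints, with $\partial_xu$ continuous on each edge up to the endpoints, and the Kirchhoff condition at every vertex. Traveling wave: $(\phi,c)$, $c>0$, is the unique pair with $\phi''+c\phi'+f(\phi)=0$ and $0<\phi<1$ on $\mathbb R$, $\phi(-\infty)=1$, $\phi(+\infty)=0$, $\phi(0)=a$. Front-like solution and limit profile on $\Omega'$: for each $i$ there is a unique entire solution $\widehat u_i$ (defined for all $t\in\mathbb R$) with $0<\widehat u_i<1$ and $\lim_{t\to-\infty}\big(\sup_{x_i\in\Omega_i'}|\widehat u_i|_{\Omega_i'}(t,x_i)-\phi(-x_i-ct)|+\sup_{\Omega'\setminus\Omega_i'}|\widehat u_i(t,\cdot)|\big)=0$; it is strictly increasing in $t$. The limit profile is $\widehat v_i(x)=\lim_{t\to\infty}\widehat u_i(t,x)$. Complete invasion is said to occur from the $i$-th outer path if $\widehat v_i\equiv1$ on $\Omega'$. *)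

(* Defs.v *)
From mathcomp Require Import all_boot all_order all_algebra.
From mathcomp Require Import all_classical all_reals all_analysis.

Set Implicit Arguments.
Unset Strict Implicit.
Unset Printing Implicit Defensive.

Import Order.TTheory GRing.Theory Num.Theory.
Import numFieldNormedType.Exports.

Local Open Scope ring_scope.
Local Open Scope classical_set_scope.

(** * Metric graphs *)

Section Joined.
Variables (R : realType) (V E : finType) (len : E -> \bar R) (src tgt : E -> V).

Definition joined : rel V := fun v w => [exists e,
  (len e != +oo%E) && (((src e == v) && (tgt e == w))
                    || ((src e == w) && (tgt e == v)))].
End Joined.

(** The edge [e] carries the coordinate [0 <= x <= len e], with [x = 0] at
    [src e].  If [len e] is finite, [x = len e] is at [tgt e]; if [len e = +oo],
    [e] is a half line and [tgt e] is a dummy value that is never used.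
    Loops and multiple edges are allowed. *)
Record metric_graph (R : realType) := MetricGraph {
  vertex : finType;
  edge : finType;
  len : edge -> \bar R;
  src : edge -> vertex;
  tgt : edge -> vertex;
  len_gt0 : forall e, (0 < len e)%E;
  graph_connected : forall v w, connect (joined len src tgt) v w
}.

Arguments len {R m} e.
Arguments src {R m} e.
Arguments tgt {R m} e.

Section Graph.
Variables (R : realType) (G : metric_graph R).

Definition bounded_graph : Prop := forall e : edge G, len e \is a fin_num.

Definition total_length : \bar R := (\sum_(e : edge G) len e)%E.

(** [OnEdge e x] is a point of the graph only if [x] is interior to [e]; see
    [points]. *)
Inductive graph_point : Type :=
  | Vertex of vertex G
  | OnEdge of edge G & R.

Definition points : set graph_point := [set p | match p with
  | Vertex _ => True
  | OnEdge e x => 0 < x /\ (x%:E < len e)%E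
  end].

Definition edge_dom (e : edge G) : set R := [set x | 0 <= x /\ (x%:E <= len e)%E].

(** The point of coordinate [x] on [e], meaningful for [x] in [edge_dom e]. *)
Definition edge_point (e : edge G) (x : R) : graph_point :=
  if x == 0 then Vertex (src e)
  else if x%:E == len e then Vertex (tgt e)
  else OnEdge e x.

(** Derivative of [w] relative to [edge_dom e]: the usual derivative inside the
    edge, the one-sided derivative (with respect to the coordinate) at its ends. *)
Definition edge_quotient (w : R -> R) (x y : R) : R := (w y - w x) / (y - x).

Definition edge_derivable (e : edge G) (w : R -> R) (x : R) : Prop :=
  cvg (edge_quotient w x y @[y --> within (edge_dom e) x^']).

Definition edge_derive (e : edge G) (w : R -> R) (x : R) : R :=
  lim (edge_quotient w x y @[y --> within (edge_dom e) x^']).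

(** The sum of the derivatives of [u] at [v] pointing into the incident edges; a
    loop at [v] occurs in both sums. *)
Definition outgoing_flux (u : graph_point -> R) (v : vertex G) : R :=
  \sum_(e : edge G | src e == v) edge_derive e (u \o edge_point e) 0
  + \sum_(e : edge G | (len e != +oo%E) && (tgt e == v))
      - edge_derive e (u \o edge_point e) (fine (len e)).

Definition kirchhoff (u : graph_point -> R) : Prop :=
  forall v, outgoing_flux u v = 0.

(** Continuity on a finite graph amounts to continuity on each closed edge. *)
Definition entire_solution (f : R -> R) (u : R -> graph_point -> R) : Prop :=
  [/\ (forall e, {within [set tx : R * R | edge_dom e tx.2],
         continuous (fun tx : R * R => u tx.1 (edge_point e tx.2))}),
      (forall e t x, 0 < x -> (x%:E < len e)%E ->
         let w := u t \o edge_point e in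
         [/\ derivable w x 1, derivable (derive1 w) x 1 &
             is_derive t 1 (fun s => u s (edge_point e x)) (derive1 (derive1 w) x + f (w x))]),
      (forall e t,
         (forall x, edge_dom e x -> edge_derivable e (u t \o edge_point e) x) /\
         {within edge_dom e, continuous (edge_derive e (u t \o edge_point e))}) &
      (forall t, kirchhoff (u t))].

Definition limit_profile (u : R -> graph_point -> R) (v : graph_point -> R) :
    Prop :=
  forall p, points p -> u t p @[t --> +oo] --> v p.

End Graph.

Arguments points {R} G.

(** * Replacing the center of a star graph *)

Section Attach.
Variables (R : realType) (D : metric_graph R) (N : nat) (P : 'I_N -> vertex D).

Definition attach_len (e : (edge D + 'I_N)%type) : \bar R :=
  match e with inl e => len e | inr _ => +oo%E end.
Definition attach_src (e : (edge D + 'I_N)%type) : vertex D :=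
  match e with inl e => src e | inr i => P i end.
Definition attach_tgt (e : (edge D + 'I_N)%type) : vertex D :=
  match e with inl e => tgt e | inr i => P i end.

Lemma attach_len_gt0 e : (0 < attach_len e)%E.
Proof. by case: e => [e|i] /=; [exact: len_gt0 | exact: ltry]. Qed.

Lemma attach_connected v w :
  connect (joined attach_len attach_src attach_tgt) v w.
Proof.
apply: connect_sub (graph_connected v w) => x y /existsP[e He].
by apply: connect1; apply/existsP; exists (inl e).
Qed.

(** [D] with, for each [i : 'I_N], a half line glued to [D] at the vertex [P i];
    the [P i] need not be distinct. *)
Definition attach : metric_graph R := MetricGraph attach_len_gt0 attach_connected.

Definition outer_edge (i : 'I_N) : edge attach := inr i.

Definition outer_path (i : 'I_N) : set (graph_point attach) :=
  [set edge_point (outer_edge i) x | x in [set x : R | 0 <= x]].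

End Attach.

Arguments outer_edge {R D N} P i.
Arguments outer_path {R D N} P i.

(** * Nonlinearity, traveling wave, front-like solutions *)

Section Invasion.
Variables (R : realType) (f : R -> R).

Definition primitive (s : R) : R :=
  if 0 <= s then \int[lebesgue_measure]_(r in `[0, s]) f r
  else - \int[lebesgue_measure]_(r in `[s, 0]) f r.

Definition bistable (a : R) : Prop :=
  [/\ (forall x, derivable f x 1) /\ continuous (derive1 f),
      0 < a < 1,
      [/\ f 0 = 0, f a = 0 & f 1 = 0],
      (forall s, 0 < s < a -> f s < 0) /\ (forall s, a < s < 1 -> 0 < f s) &
      [/\ derive1 f 0 < 0, 0 < derive1 f a, derive1 f 1 < 0 & 0 < primitive 1]].

Definition traveling_wave (a : R) (phi : R -> R) (c : R) : Prop :=
  [/\ 0 < c,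
      (forall x, [/\ derivable phi x 1, derivable (derive1 phi) x 1 &
         derive1 (derive1 phi) x + c * derive1 phi x + f (phi x) = 0]),
      (forall x, 0 < phi x < 1),
      (phi x @[x --> -oo] --> (1 : R)) /\ (phi x @[x --> +oo] --> (0 : R)) &
      phi 0 = a].

(** [u] is the front-like entire solution coming from the [i]-th outer path.
    Both suprema are over nonempty bounded sets when [0 < u < 1], [0 < phi < 1]
    and [2 <= N]. *)
Definition front_like (phi : R -> R) (c : R) (D : metric_graph R) (N : nat)
    (P : 'I_N -> vertex D) (i : 'I_N) (u : R -> graph_point (attach P) -> R) :
    Prop :=
  [/\ entire_solution f u,
      (forall t p, points _ p -> 0 < u t p < 1) &
      sup [set `|u t (edge_point (outer_edge P i) x) - phi (- x - c * t)|
            | x in [set x : R | 0 <= x]]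
      + sup [set `|u t p| | p in points (attach P) `\` outer_path P i]
        @[t --> -oo] --> (0 : R)].

(** There is exactly one front-like solution, so quantifying over [u] is a description of
    the front-like solution; its limit profile is required to be the constant 1. *)
Definition complete_invasion (phi : R -> R) (c : R) (D : metric_graph R)
    (N : nat) (P : 'I_N -> vertex D) (i : 'I_N) : Prop :=
  forall u : R -> graph_point (attach P) -> R, front_like phi c i u ->
    limit_profile u (fun=> 1).

End Invasion.

(* Main.v *)
Require Import Defs.
From HB Require Import structures.
From mathcomp Require Import all_boot all_order all_algebra.
From mathcomp Require Import all_classical all_reals all_analysis.
From mathcomp Require Import ring lra.

Set Implicit Arguments.
Unset Strict Implicit.
Unset Printing Implicit Defensive.

Import Order.TTheory GRing.Theory Num.Theory.
Import numFieldNormedType.Exports.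

Local Open Scope ring_scope.
Local Open Scope classical_set_scope.

(** Why complete invasion occurs.  Compare the front-like solution [u] from below
    with strict stationary subsolutions that are moved slowly by a parameter.  If
    [u] starts above such a barrier and the two ever meet, consider the first
    contact.  In the interior of an edge, the barrier forces [u_t >= eta > 0]
    there, so just before [u] was below a barrier moving at a lower speed
    ([no_interior_contact]); at a vertex, the outward slopes of [u] dominate those
    of the barrier, whose sum is positive, against Kirchhoff's condition
    ([no_vertex_contact]).  So [u] stays above ([comparison]).  Barriers are
    subsolutions in a weak sense that permits convex kinks.  Three families of
    them are used.

    The first one ([crossing]) carries [u] from the [i]-th path through [D].  Choose
    [b < 1] close to [1].  On the [i]-th path the barrier is a bump that starts far
    out, where [u] is close to [1], and then moves towards [D] until the vertex
    meets its rising side; that side is an orbit of [w'' + f w = 0] of kinetic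
    energy about [F b - F s] at height [s].  On the other [n = N - 1] paths it
    descends from the vertex along an orbit too.  If [D] were a point, the barrier
    at height [s] on [D] would satisfy the strict slope condition when
    [n * (slope of a descending profile) < slope of the rising profile], that is,
    when the descending kinetic energy at height [s] is below
    [(F b - F s) / n ^ 2].  An orbit has a constant sum of kinetic energy and [F];
    since [F] has its minimum on [0, 1] at [a], the binding height is [s = a], and
    the descending orbit reaches [0] if
    [(F b - F a) / n ^ 2 + F a > 0], which is the hypothesis
    [F 1 + (n ^ 2 - 1) * F a > 0] for [b] close to [1].  (Above [a] such an orbit may
    fail to exist; there it is continued by a subsolution of kinetic energy
    [(F b - F s) / n ^ 2].)  Strictness leaves a gap between the slopes, uniform in
    [s] ([slope_gap]).

    When [D] is not a point, the barrier on [D] is [s] plus a multiple of a function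
    with constant second derivative on every edge and with prescribed fluxes at
    the vertices, carrying the slopes from [P i] to the other [P j]
    ([crossing_potential]).  The second derivative outweighs [- f].  An energy
    identity bounds this function by the total length of [D] times the total
    current, whatever the shape of [D] ([graph_poisson]).  So a small length
    changes heights and slopes by less than the gap, and the smallness needed
    depends on [f] and [N] alone.

    Once [u] exceeds a level [l] with [F l > 0] on [D] for ever, a lower bump is
    moved out of the vertex along every path ([bump_sweep]), so that [u] exceeds a
    level above [a] on any bounded set.  Finally wide and flat parabolas, joined by a
    small potential on [D], lift [u] to [1] there ([fill]). *)

(** * Calculus *)

(** The [is_derive] instances give the derivative only up to a ring identity. *)
Ltac derive_by_rules := apply: is_derive_eq; rewrite /GRing.scale /=; try ring.

Section Calculus.
Context {R : realType}.
Implicit Types (f g h u v q W : R -> R).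

Lemma is_derive_primitive h (x : R) : continuous h ->
  is_derive x 1 (primitive h) (h x).
Proof.
move=> ch.
pose K : R := `|x| + 1.
pose I (y : R) : R := \int[lebesgue_measure]_(r in `[- K, y]) h r.
have Kx : - K < x by rewrite /K; have := ler_norm (- x); rewrite normrN; lra.
have K0 : - K < 0 by rewrite /K; have := normr_ge0 x; lra.
have hint (y z : R) : lebesgue_measure.-integrable `[y, z] (EFin \o h).
  apply: continuous_compact_integrable; first exact: segment_compact.
  exact: continuous_subspaceT.
have ieq (y z : R) : - K <= y -> y <= z ->
    I z - I y = \int[lebesgue_measure]_(r in `[y, z]) h r.
  move=> Ky yz; rewrite /I Rintegral_itvB ?bnd_simp //.
  rewrite Rintegral_itv_obnd_cbnd //.
  by apply: integrableS (hint y z) => //; apply: subset_itv_oc_cc.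
have primE (y : R) : - K < y -> primitive h y = I y - I 0.
  move=> Ky; rewrite /primitive; case: ifPn => y0.
    by rewrite ieq // ltW.
  by rewrite -ieq ?opprB // ltW // ltNge.
have [dI I'] : derivable I x 1 /\ I^`() x = h x.
  by apply: (@continuous_FTC1_closed _ h (- K) x (x + 1)) => //; [lra|exact: ch].
have dIx : is_derive x 1 I (h x).
  by split; [exact: dI|rewrite -derive1E].
have dIc : is_derive x 1 (fun y => I y - I 0) (h x).
  by derive_by_rules.
apply: near_eq_is_derive dIc.
near=> y; apply/esym; apply: primE; near: y; exact: lt_nbhsr.
Unshelve. all: end_near. Qed.

Lemma is_derive_continuous f (df : R -> R) :
  (forall x : R, is_derive x 1 f (df x)) -> continuous f.
Proof.
by move=> df_ x; apply: differentiable_continuous; apply/derivable1_diffP; case: (df_ x).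
Qed.

Lemma is_derive_within_continuous f (df : R -> R) (a b : R) :
  (forall x : R, is_derive x 1 f (df x)) -> {within `[a, b], continuous f}.
Proof. by move=> /is_derive_continuous cf; exact: continuous_subspaceT. Qed.

Lemma derive_pos_lt f (df : R -> R) :
  (forall x : R, is_derive x 1 f (df x)) -> (forall x, 0 < df x) ->
  forall x y, x < y -> f x < f y.
Proof.
move=> dfx df0 x y xy.
have [z _ E] := MVT xy (fun z _ => dfx z) (is_derive_within_continuous dfx).
by rewrite -subr_gt0 E mulr_gt0 // subr_gt0.
Qed.

Lemma derive_bounded_lipschitz f (df : R -> R) (k : R) :
  (forall x : R, is_derive x 1 f (df x)) -> (forall x, `|df x| <= k) ->
  forall x y, `|f y - f x| <= k * `|y - x|.
Proof.
move=> dfx dfk.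
have aux x y : x < y -> `|f y - f x| <= k * `|y - x|.
  move=> xy; have [z _ ->] := MVT xy (fun z _ => dfx z) (is_derive_within_continuous dfx).
  by rewrite normrM ler_wpM2r.
move=> x y; case: (ltgtP x y) => [|yx|->]; first exact: aux.
  by rewrite distrC (distrC y); exact: aux.
by rewrite !subrr normr0 mulr0.
Qed.

(** Separation of variables: the solution of [W' = - g W] is the inverse of a
    primitive of [- 1 / g]; the bounds on [g] make both global. *)
Lemma autonomous_flow g (b gmin gmax : R) : continuous g -> 0 < gmin ->
  (forall s, gmin <= g s <= gmax) ->
  exists W psi : R -> R, [/\ W 0 = b, cancel W psi, cancel psi W,
    forall x : R, is_derive x 1 W (- g (W x)) &
    forall s : R, is_derive s 1 psi (- (g s)^-1)].
Proof.
move=> cg gmin0 gb.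
have g0 s : 0 < g s by have /andP[+ _] := gb s; exact: lt_le_trans.
have gmax0 : 0 < gmax by have /andP[_] := gb 0; exact: lt_le_trans.
pose h := fun s => (g s)^-1.
have ch : continuous h by move=> s; apply: cvgV; [rewrite gt_eqF|exact: cg].
pose H := fun s => primitive h s - primitive h b.
have dH (s : R) : is_derive s 1 H (h s).
  have ? := is_derive_primitive s ch.
  by derive_by_rules.
have h0 s : 0 < h s by rewrite invr_gt0.
have Hlt := derive_pos_lt dH h0.
have Hinj : injective H.
  by move=> x y; case: (ltgtP x y) => // /Hlt /[swap] ->; rewrite ltxx.
have Hb : H b = 0 by rewrite /H subrr.
have hmax s : gmax^-1 <= h s.
  by rewrite lef_pV2 ?posrE //; have /andP[] := gb s.
have grow x y : x < y -> gmax^-1 * (y - x) <= H y - H x.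
  move=> xy; have [z _ ->] := MVT xy (fun z _ => dH z) (is_derive_within_continuous dH).
  by rewrite ler_wpM2r // subr_ge0 ltW.
have surj t : exists s, H s = t.
  pose r := gmax * `|t| + 1.
  have r0 : 0 < r by rewrite /r ltr_wpDl // mulr_ge0 // ltW.
  have er : gmax^-1 * r = `|t| + gmax^-1.
    by rewrite /r mulrDr mulr1 mulrA mulVf ?mul1r ?gt_eqF.
  have i0 : 0 < gmax^-1 by rewrite invr_gt0.
  have l1 : t <= H (b + r).
    have := @grow b (b + r); rewrite addrAC subrr add0r er Hb subr0.
    by move=> /(_ ltac:(lra)); have := ler_norm t; lra.
  have l2 : H (b - r) <= t.
    have := @grow (b - r) b; rewrite subKr er Hb sub0r => /(_ ltac:(lra)).
    by have := ler_norm (- t); rewrite normrN; lra.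
  have hIVT : Num.min (H (b - r)) (H (b + r)) <= t <= Num.max (H (b - r)) (H (b + r)).
    by rewrite ge_min l2 le_max l1 orbT.
  have brr : b - r <= b + r by lra.
  by have [s _ <-] := IVT brr (is_derive_within_continuous dH) hIVT; exists s.
pose Hinv t := xget b [set s | H s = t].
have HK t : H (Hinv t) = t.
  rewrite /Hinv; case: xgetP => [y _ //|]; case: (surj t) => s Hs /(_ s); by rewrite /= Hs.
have KH s : Hinv (H s) = s by apply: Hinj; rewrite HK.
have cH := is_derive_continuous dH.
have dHinv (t : R) : is_derive t 1 Hinv (g (Hinv t)).
  have := @is_derive_inverse _ H Hinv (h (Hinv t)) (Hinv t).
  rewrite HK /h invrK; apply.
  - by near=> z.
  - by near=> z; exact: cH.
  - by rewrite gt_eqF // invr_gt0.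
exists (fun x => Hinv (- x)), (fun s => - H s); split.
- by rewrite oppr0 -Hb KH.
- by move=> x; rewrite /= HK opprK.
- by move=> s; rewrite /= opprK KH.
- move=> x.
  have D1 : is_derive (x : R) 1 (fun y : R => - y) (- 1) by derive_by_rules.
  have := dHinv (- x); move=> D2.
  have := @is_derive1_comp _ Hinv (fun y => - y) x _ _ D2 D1.
  by rewrite mulrN1.
- by move=> s; have := dH s => ?; derive_by_rules.
Unshelve. all: end_near. Qed.

Lemma derive_neg_growth d (x D : R) : is_derive x 1 d D -> D < 0 ->
  exists2 r : R, 0 < r &
    forall t, 0 < `|t| -> `|t| < r -> t^-1 * (d (x + t) - d x) < 0.
Proof.
move=> [+ E] D0; rewrite /derivable => cv.
have : (fun t : R => t^-1 *: ((d \o shift x) (t *: 1) - d x)) @ 0^' --> D.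
  by rewrite -E; exact: cv.
move=> /cvgr_lt /(_ 0 D0) /=; rewrite near_withinE => /nbhs_ballP[r /= r0 Hr].
exists r => // t t0 tr; have := Hr t; rewrite /ball /= sub0r normrN => /(_ tr).
by rewrite -normr_gt0 => /(_ t0); rewrite (addrC x) /GRing.scale /= mulr1.
Qed.

(** Otherwise [u - q], which has a critical point at [x], would decrease to the
    right of [x]. *)
Lemma touching_above_derive2 u q (q' : R -> R) (q'' x : R) :
  (\forall y \near x, derivable u (y : R) 1) -> derivable (derive1 u) x 1 ->
  (\forall y \near x, is_derive (y : R) 1 q (q' y)) -> is_derive x 1 q' q'' ->
  u x = q x -> (\forall y \near x, q y <= u y) ->
  q'' <= derive1 (derive1 u) x.
Proof.
move=> du ddu dq ddq eux leq.
rewrite leNgt; apply/negP => lt2.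
have [e e0 He] : exists2 e : R, 0 < e & forall y, `|x - y| < e ->
    [/\ derivable u (y : R) 1, is_derive (y : R) 1 q (q' y) & q y <= u y].
  have : \forall y \near x, [/\ derivable u (y : R) 1, is_derive (y : R) 1 q (q' y) & q y <= u y].
    near=> y; split; near: y => //.
  by move=> /nbhs_ballP[e /= e0 He]; exists e => // y; apply: He.
pose d y := u y - q y.
pose d' y := derive1 u y - q' y.
have dd (y : R) : `|x - y| < e -> is_derive y 1 d (d' y).
  move=> /He[uy qy _]; have uy' := derivableP uy; rewrite -derive1E in uy'.
  exact: is_deriveB.
have dx0 : d' x = 0.
  have xe : `|x - x| < e by rewrite subrr normr0.
  have [dx1 dx2] := dd x xe.
  have xI : x \in `](x - e / 2), (x + e / 2)[%R by rewrite in_itv /=; apply/andP; split; lra.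
  have cl y : y \in `](x - e / 2), (x + e / 2)[%R -> `|x - y| < e.
    by rewrite in_itv /= ltr_norml => /andP[? ?]; apply/andP; split; lra.
  have [] := @derive1_at_min _ d (x - e / 2) (x + e / 2) x _ _ xI.
  - lra.
  - by move=> y yI; have [] := dd y (cl _ yI).
  - move=> y yI; rewrite /d eux subrr subr_ge0; by have [] := He y (cl _ yI).
  by move=> _ <-; rewrite dx2.
have dd' : is_derive x 1 d' (derive1 (derive1 u) x - q'').
  by have := derivableP ddu; rewrite -derive1E => ?; exact: is_deriveB.
have [r [r0 re rneg]] : exists r : R,
    [/\ 0 < r, r < e & forall t, 0 < t -> t < r -> d' (x + t) < 0].
  have [|r r0 Hr] := derive_neg_growth dd'; first by rewrite subr_lt0.
  have mr : Num.min r e <= r by rewrite ge_min lexx.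
  have me : Num.min r e <= e by rewrite ge_min lexx orbT.
  have m0 : 0 < Num.min r e by rewrite lt_min r0.
  exists (Num.min r e / 2); split; [lra|lra|move=> t t0 tr].
  have := Hr t; rewrite gtr0_norm // dx0 subr0 => /(_ t0 ltac:(lra)).
  by rewrite pmulr_rlt0 ?invr_gt0.
have [z zI] : exists2 z, z \in `]x, (x + r)[%R & d (x + r) - d x = d' z * (x + r - x).
  apply: MVT; first lra.
  - move=> z; rewrite in_itv /= => /andP[? ?]; apply: dd.
    by rewrite ltr_norml; apply/andP; split; lra.
  - apply: derivable_within_continuous => z; rewrite in_itv /= => /andP[? ?].
    suff [] : is_derive z 1 d (d' z) by [].
    by apply: dd; rewrite ltr_norml; apply/andP; split; lra.
move: zI; rewrite in_itv /= => /andP[z1 z2].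
have d'z : d' z < 0.
  by have := rneg (z - x); rewrite addrCA subrr addr0; apply; lra.
have dx : d x = 0 by rewrite /d eux subrr.
have dxr : 0 <= d (x + r).
  rewrite /d subr_ge0; have [] // := He (x + r).
  by rewrite ltr_norml; apply/andP; split; lra.
rewrite dx subr0 addrAC subrr add0r => E.
by have := nmulr_rlt0 r d'z; rewrite -E r0 ltNge dxr.
Unshelve. all: end_near. Qed.

Lemma dist_min_le (x y c : R) : `|Num.min x c - Num.min y c| <= `|x - y|.
Proof.
have := ler_norm (x - y); have := ler_norm (- (x - y)); rewrite normrN.
move: `|x - y| => d l1 l2; rewrite ler_norml /Num.min.
by case: (ltP x c) => ?; case: (ltP y c) => ?; apply/andP; split; lra.
Qed.

Lemma dist_max_le (x y c : R) : `|Num.max x c - Num.max y c| <= `|x - y|.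
Proof.
have := ler_norm (x - y); have := ler_norm (- (x - y)); rewrite normrN.
move: `|x - y| => d l1 l2; rewrite ler_norml /Num.max.
by case: (ltP x c) => ?; case: (ltP y c) => ?; apply/andP; split; lra.
Qed.

End Calculus.

(** * Stationary barriers on the line *)

Section Barriers.
Context {R : realType}.
Implicit Types (f v w q A W : R -> R).

(** The second order part of a strict stationary subsolution of
    [u_t = u_xx + f u], in the viscosity sense; so [w] may have convex kinks, and
    only values of [w] between [0] and [1] matter. *)
Definition barrier_at f (eta : R) w (x : R) : Prop := forall v,
  (\forall y \near x, derivable v (y : R) 1) -> derivable (derive1 v) x 1 ->
  v x = w x -> 0 < v x < 1 -> (\forall y \near x, w y <= v y) ->
  eta <= derive1 (derive1 v) x + f (v x).

Lemma smooth_barrier f eta w q (q' : R -> R) (q'' x : R) :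
  (\forall y \near x, w y = q y) ->
  (\forall y \near x, is_derive (y : R) 1 q (q' y)) -> is_derive x 1 q' q'' ->
  (0 < q x < 1 -> eta <= q'' + f (q x)) -> barrier_at f eta w x.
Proof.
move=> wq dq ddq qf v dv ddv vw v01 wv.
have vq : v x = q x by rewrite vw (nbhs_singleton wq).
have := @touching_above_derive2 _ v q q' q'' x dv ddv dq ddq vq.
have qv : \forall y \near x, q y <= v y by near=> y; rewrite -(near wq y) //; near: y.
move=> /(_ qv); move: qf; rewrite -vq => /(_ v01); lra.
Unshelve. all: end_near. Qed.

Lemma touching_slope_right v q (x v' q' : R) :
  is_derive x 1 v v' -> is_derive x 1 q q' -> v x = q x ->
  (\forall y \near x, x <= y -> q y <= v y) -> q' <= v'.
Proof.
move=> dv dq vq /nbhs_ballP[e /= e0 He]; rewrite leNgt; apply/negP => lt.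
have dd : is_derive x 1 (fun y => v y - q y) (v' - q') by exact: is_deriveB.
have [|r r0 Hr] := derive_neg_growth dd; first by rewrite subr_lt0.
have mr : Num.min r e <= r by rewrite ge_min lexx.
have me : Num.min r e <= e by rewrite ge_min lexx orbT.
have m0 : 0 < Num.min r e by rewrite lt_min r0.
pose t := Num.min r e / 2; have t0 : 0 < t by rewrite /t; lra.
have := Hr t; rewrite gtr0_norm // => /(_ t0 ltac:(rewrite /t; lra)).
rewrite pmulr_rlt0 ?invr_gt0 // vq subrr subr0 subr_lt0 ltNge => /negP; apply.
apply: He; last by lra.
by rewrite /ball /= opprD addrA subrr sub0r normrN gtr0_norm // /t; lra.
Qed.

Lemma touching_slope_left v q (x v' q' : R) :
  is_derive x 1 v v' -> is_derive x 1 q q' -> v x = q x ->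
  (\forall y \near x, y <= x -> q y <= v y) -> v' <= q'.
Proof.
move=> dv dq vq /nbhs_ballP[e /= e0 He]; rewrite leNgt; apply/negP => lt.
have dd : is_derive x 1 (fun y => q y - v y) (q' - v') by exact: is_deriveB.
have [|r r0 Hr] := derive_neg_growth dd; first by rewrite subr_lt0.
have mr : Num.min r e <= r by rewrite ge_min lexx.
have me : Num.min r e <= e by rewrite ge_min lexx orbT.
have m0 : 0 < Num.min r e by rewrite lt_min r0.
pose t := Num.min r e / 2; have t0 : 0 < t by rewrite /t; lra.
have := Hr (- t); rewrite normrN gtr0_norm // => /(_ t0 ltac:(rewrite /t; lra)).
rewrite vq subrr subr0 invrN mulNr oppr_lt0 pmulr_rgt0 ?invr_gt0 // subr_gt0.
rewrite ltNge => /negP; apply; apply: He; last by lra.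
by rewrite /ball /= opprB addrCA subrr addr0 gtr0_norm // /t; lra.
Qed.

(** Vacuously: a differentiable function cannot touch a convex kink from above. *)
Lemma kink_barrier f eta w q1 q2 (p1 p2 x : R) :
  is_derive x 1 q1 p1 -> is_derive x 1 q2 p2 -> p1 < p2 ->
  (\forall y \near x, y <= x -> w y = q1 y) ->
  (\forall y \near x, x <= y -> w y = q2 y) -> barrier_at f eta w x.
Proof.
move=> d1 d2 p12 w1 w2 v dv ddv vw v01 wv; exfalso.
have /derivableP dvx := nbhs_singleton dv.
have v1 : v x = q1 x by rewrite vw (nbhs_singleton w1).
have v2 : v x = q2 x by rewrite vw (nbhs_singleton w2).
have := @touching_slope_left _ _ _ _ _ dvx d1 v1.
have := @touching_slope_right _ _ _ _ _ dvx d2 v2.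
have H2 : \forall y \near x, x <= y -> q2 y <= v y.
  by near=> y => xy; rewrite -(near w2 y) //; near: y.
have H1 : \forall y \near x, y <= x -> q1 y <= v y.
  by near=> y => xy; rewrite -(near w1 y) //; near: y.
by move=> /(_ H2) ? /(_ H1) ?; lra.
Unshelve. all: end_near. Qed.

Definition clamp (b s : R) : R := Num.max 0 (Num.min b s).
(** In the phase plane of [w'' = A'(w)], the orbit with kinetic energy [A] has this
    slope at height [s].  Freezing it outside [0 <= s <= b] makes the orbit global. *)
Definition slope A (b s : R) : R := Num.sqrt (2 * A (clamp b s)).

Lemma clamp_id (b s : R) : 0 <= s -> s <= b -> clamp b s = s.
Proof. by move=> s0 sb; rewrite /clamp min_r // max_r. Qed.

Lemma clamp_itv (b s : R) : 0 <= b -> 0 <= clamp b s <= b.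
Proof.
by move=> b0; rewrite /clamp le_max lexx /= ge_max b0 ge_min lexx.
Qed.

Lemma clamp_lipschitz (b s t : R) : `|clamp b s - clamp b t| <= `|s - t|.
Proof.
rewrite /clamp ![Num.max 0 _]maxC ![Num.min b _]minC.
exact: le_trans (dist_max_le _ _ _) (dist_min_le _ _ _).
Qed.

Lemma lipschitz_continuous (g : R -> R) (k : R) :
  (forall s t, `|g s - g t| <= k * `|s - t|) -> continuous g.
Proof.
move=> gk x; apply/cvgrPdist_le => /= e e0.
near=> y; apply: le_trans (gk x y) _.
have k0 : 0 < `|k| + 1 by have := normr_ge0 k; lra.
apply: (@le_trans _ _ ((`|k| + 1) * `|x - y|)).
  by rewrite ler_wpM2r //; have := ler_norm k; lra.
rewrite mulrC -ler_pdivlMr //; near: y.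
by apply: cvgr_dist_le; rewrite ?divr_gt0.
Unshelve. all: end_near. Qed.

Section Profile.
Variables (f A A' : R -> R) (b eta : R).
Hypothesis b0 : 0 < b.
Hypothesis eta0 : 0 < eta.
Hypothesis dA : forall s : R, is_derive s 1 A (A' s).
Hypothesis cA' : continuous A'.
Hypothesis A_ge : forall s : R, 0 <= s <= b -> eta <= A s.
Hypothesis A_sub : forall s : R, 0 <= s <= b -> eta <= A' s + f s.

Let gmin : R := Num.sqrt (2 * eta).

Lemma slope_ge s : gmin <= slope A b s.
Proof. by rewrite ler_wsqrtr // ler_pM2l // A_ge // clamp_itv // ltW. Qed.

Lemma slope_min_gt0 : 0 < gmin.
Proof. by rewrite sqrtr_gt0 mulr_gt0. Qed.

Lemma slope_gt0 s : 0 < slope A b s.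
Proof. exact: lt_le_trans slope_min_gt0 (slope_ge s). Qed.

Lemma slope_sqr s : slope A b s ^+ 2 = 2 * A (clamp b s).
Proof.
by rewrite sqr_sqrtr // mulr_ge0 // (le_trans (ltW eta0)) // A_ge // clamp_itv // ltW.
Qed.

Lemma slope_bounded : exists2 gmax, 0 < gmax & forall s, slope A b s <= gmax.
Proof.
have [c _ Hc] := EVT_max (ltW b0) (is_derive_within_continuous dA).
have sA s : A (clamp b s) <= A c by apply: Hc; rewrite in_itv; exact: clamp_itv (ltW b0).
have le s : slope A b s <= Num.sqrt (2 * A c) by rewrite ler_wsqrtr // ler_pM2l.
by exists (Num.sqrt (2 * A c)) => //; exact: lt_le_trans (slope_gt0 0) (le 0).
Qed.

Lemma slope_lipschitz : exists2 k, 0 < k &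
  forall s t, `|slope A b s - slope A b t| <= k * `|s - t|.
Proof.
have cnA' : {within `[0, b], continuous (fun s => `|A' s|)}.
  by apply: continuous_subspaceT => s; apply: cvg_norm; exact: cA'.
have [c _ Hc] := EVT_max (ltW b0) cnA'.
have gm0 := slope_min_gt0.
exists ((`|A' c| + 1) / gmin) => [|s t]; first by rewrite divr_gt0 // ltr_wpDl.
set x := clamp b s; set y := clamp b t.
have Axy : `|A x - A y| <= (`|A' c| + 1) * `|x - y|.
  have aux z1 z2 : 0 <= z1 -> z1 < z2 -> z2 <= b ->
      `|A z2 - A z1| <= (`|A' c| + 1) * `|z2 - z1|.
    move=> z10 z12 z2b.
    have [z + ->] := MVT z12 (fun z _ => dA z) (is_derive_within_continuous dA).
    rewrite in_itv /= => /andP[? ?].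
    rewrite normrM ler_wpM2r //; apply: le_trans (_ : `|A' c| <= _); last by lra.
    by apply: Hc; rewrite in_itv /=; apply/andP; split; lra.
  have /andP[x0 xb] := clamp_itv s (ltW b0); have /andP[y0 yb] := clamp_itv t (ltW b0).
  case: (ltgtP x y) => [xy|yx|->]; last by rewrite !subrr normr0 mulr0.
    by rewrite distrC (distrC x); exact: aux.
  exact: aux.
have E : (slope A b s - slope A b t) * (slope A b s + slope A b t) = 2 * (A x - A y).
  by rewrite -subr_sqr !slope_sqr -mulrBr.
have sum_ge : 2 * gmin <= slope A b s + slope A b t.
  by have := slope_ge s; have := slope_ge t; lra.
have {E} : `|slope A b s - slope A b t| * (slope A b s + slope A b t) = 2 * `|A x - A y|.
  have sum0 : 0 <= slope A b s + slope A b t by lra.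
  by rewrite -{1}(ger0_norm sum0) -normrM E normrM normr_nat.
move=> E.
rewrite mulrAC ler_pdivlMr //.
have /(ler_wpM2l (normr_ge0 (slope A b s - slope A b t))) := sum_ge; rewrite E.
have := clamp_lipschitz b s t; rewrite -/x -/y.
have k0 : 0 <= `|A' c| + 1 by have := normr_ge0 (A' c); lra.
by move=> /(ler_wpM2l k0); lra.
Qed.

Lemma slope_continuous : continuous (slope A b).
Proof. by have [k _ /lipschitz_continuous] := slope_lipschitz. Qed.

Lemma is_derive_slope (s : R) : 0 < s -> s < b ->
  is_derive s 1 (slope A b) (A' s / slope A b s).
Proof.
move=> s0 sb.
have As0 : 0 < A s.
  by rewrite (lt_le_trans eta0) // A_ge // (ltW s0) (ltW sb).
have ss : slope A b s = Num.sqrt (2 * A s) by rewrite /slope clamp_id // ltW.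
have dsq : is_derive s 1 (fun y => Num.sqrt (2 * A y)) (A' s / slope A b s).
  have d2 : is_derive s 1 (fun y => 2 * A y) (2 * A' s).
    by have := dA s => ?; derive_by_rules.
  have d3 : is_derive (2 * A s) 1 Num.sqrt (2 * Num.sqrt (2 * A s))^-1.
    by apply: is_derive1_sqrt; rewrite mulr_gt0.
  have := is_derive1_comp (f := Num.sqrt) (g := fun y => 2 * A y) d3 d2.
  move=> H; apply: is_derive_eq H _.
  by rewrite ss invfM; field; rewrite gt_eqF // sqrtr_gt0 mulr_gt0.
apply: near_eq_is_derive dsq; near=> y; rewrite /slope clamp_id //.
- by apply: ltW; near: y; exact: lt_nbhsr.
- by apply: ltW; near: y; exact: lt_nbhsl.
Unshelve. all: end_near. Qed.

Lemma slope_profile : exists W psi : R -> R, [/\ W 0 = b, cancel W psi, cancel psi W,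
    forall x : R, is_derive x 1 W (- slope A b (W x)) &
    forall s : R, is_derive s 1 psi (- (slope A b s)^-1)].
Proof.
have [gmax gmax0 gle] := slope_bounded.
apply: (@autonomous_flow _ _ _ gmin gmax slope_continuous slope_min_gt0) => s.
by rewrite slope_ge gle.
Qed.

(** Differentiating [W' = - slope A b W] gives [W'' = A'(W)]. *)
Lemma profile_barrier W (sg c x : R) :
  (forall x : R, is_derive x 1 W (- slope A b (W x))) ->
  sg ^+ 2 = 1 -> W (sg * x + c) < b ->
  barrier_at f eta (fun y => W (sg * y + c)) x.
Proof.
move=> dW sg2 Wb v dv ddv vw v01 wv.
have W0 : 0 < W (sg * x + c) by rewrite -vw; case/andP: v01.
have dl (y : R) : is_derive y 1 (fun y => sg * y + c) sg.
  by derive_by_rules.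
have dw (y : R) : is_derive y 1 (fun y => W (sg * y + c)) (- slope A b (W (sg * y + c)) * sg).
  exact: (is_derive1_comp (f := W)).
suff: barrier_at f eta (fun y => W (sg * y + c)) x by apply.
apply: (@smooth_barrier f eta _ _ (fun y => - slope A b (W (sg * y + c)) * sg)
  (A' (W (sg * x + c))) x).
- by near=> y.
- by near=> y.
- have ds := is_derive_slope W0 Wb.
  have := is_derive1_comp (f := slope A b) (g := fun y => W (sg * y + c)) ds (dw x) => dcomp.
  have g0 := slope_gt0 (W (sg * x + c)).
  have : is_derive x 1 (fun y => (- sg) * slope A b (W (sg * y + c)))
     ((- sg) * (A' (W (sg * x + c)) / slope A b (W (sg * x + c)) *
        (- slope A b (W (sg * x + c)) * sg))).
    by derive_by_rules.
  have -> : (fun y => - sg * slope A b (W (sg * y + c))) = (fun y => - slope A b (W (sg * y + c)) * sg).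
    by apply/funext => y; rewrite mulrC mulrN mulNr.
  move=> H; apply: is_derive_eq H _.
  rewrite -[RHS]mul1r -sg2; field; by rewrite gt_eqF.
- by move=> _; apply: A_sub; rewrite (ltW W0) (ltW Wb).
Unshelve. all: end_near. Qed.

End Profile.

Section Bump.
Variables (f W slopeW : R -> R) (b eta kappa rho gmax : R).
Hypothesis rho0 : 0 < rho.
Hypothesis kappa0 : 0 < kappa.
Hypothesis W0 : W 0 = b.
Hypothesis dW : forall x : R, is_derive x 1 W (- slopeW (W x)).
Hypothesis slopeW_gt0 : forall s, 0 < slopeW s.
Hypothesis slopeW_le : forall s, slopeW s <= gmax.

(** The cap replaces the top of an orbit, where the slope vanishes and
    [W' = - g W] degenerates. *)
Definition bump (y : R) : R :=
  if `|y| <= rho then b + kappa / 2 * (rho ^+ 2 - y ^+ 2) else W (`|y| - rho).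

Definition bump_top : R := b + kappa / 2 * rho ^+ 2.

Lemma bump_tail (y : R) : rho <= `|y| -> bump y = W (`|y| - rho).
Proof.
rewrite /bump; case: (ltgtP `|y| rho) => // yr _.
by rewrite yr subrr W0 -yr real_normK ?num_real // subrr mulr0 addr0.
Qed.

Lemma bump0 : bump 0 = bump_top.
Proof. by rewrite /bump normr0 (ltW rho0) expr0n subr0. Qed.

Lemma profile_decr (x y : R) : x < y -> W y < W x.
Proof.
move=> xy.
have [z _ E] := MVT xy (fun z _ => dW z) (is_derive_within_continuous dW).
by rewrite -subr_lt0 E mulNr oppr_lt0 mulr_gt0 ?subr_gt0.
Qed.

Lemma profile_lipschitz (x y : R) : `|W x - W y| <= gmax * `|x - y|.
Proof.
apply: (derive_bounded_lipschitz dW) => z.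
by rewrite normrN gtr0_norm.
Qed.

Lemma bump_le_top (y : R) : bump y <= bump_top.
Proof.
rewrite /bump /bump_top; case: ifPn => yr.
  rewrite lerD2l ler_wpM2l ?divr_ge0 ?(ltW kappa0) //.
  by rewrite lerBlDr lerDl sqr_ge0.
have : W (`|y| - rho) < W 0 by apply: profile_decr; rewrite subr_gt0 ltNge.
rewrite W0 => /ltW /le_trans; apply; rewrite lerDl mulr_ge0 ?sqr_ge0 //.
by rewrite divr_ge0 ?(ltW kappa0).
Qed.

Lemma bump_lipschitz (x y : R) :
  `|bump x - bump y| <= (kappa * rho + gmax) * `|x - y|.
Proof.
pose m (z : R) : R := Num.min `|z| rho; pose t (z : R) : R := Num.max (`|z| - rho) 0.
have bE z : bump z = b + kappa / 2 * (rho ^+ 2 - m z ^+ 2) + (W (t z) - b).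
  rewrite /bump /m /t; case: (leP `|z| rho) => zr.
    by rewrite max_r ?subr_le0 // W0 subrr addr0 real_normK ?num_real.
  by rewrite max_l ?subr_ge0 ?(ltW zr) //; ring.
have m_bd z : 0 <= m z <= rho by rewrite le_min normr_ge0 (ltW rho0) ge_min lexx orbT.
have mxy : `|m x - m y| <= `|x - y|.
  exact: le_trans (dist_min_le _ _ _) (ler_dist_dist x y).
have txy : `|t x - t y| <= `|x - y|.
  apply: le_trans (dist_max_le _ _ _) _.
  by rewrite opprB addrA subrK; exact: ler_dist_dist.
have -> : bump x - bump y =
    kappa / 2 * ((m y - m x) * (m y + m x)) + (W (t x) - W (t y)).
  by rewrite !bE; ring.
apply: le_trans (ler_normD _ _) _; rewrite [leRHS]mulrDl; apply: lerD; last first.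
  apply: le_trans (profile_lipschitz _ _) _; rewrite ler_wpM2l //.
  by apply: le_trans (slopeW_le 0); rewrite ltW.
have := m_bd x; have := m_bd y => /andP[my0 my1] /andP[mx0 mx1].
rewrite normrM (normrM (m y - m x)) (ger0_norm (_ : 0 <= m y + m x)) ?addr_ge0 //.
rewrite (distrC (m y)) (gtr0_norm (_ : 0 < kappa / 2)) ?divr_gt0 //.
have -> : kappa * rho * `|x - y| = kappa / 2 * (`|x - y| * (rho + rho)) by field.
by rewrite ler_wpM2l ?divr_ge0 ?(ltW kappa0) // ler_pM ?addr_ge0 ?lerD.
Qed.

Lemma bump_continuous : continuous bump.
Proof. exact: lipschitz_continuous bump_lipschitz. Qed.

Lemma bump_le0 (Y y : R) : W Y <= 0 -> 0 <= Y -> rho + Y <= `|y| -> bump y <= 0.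
Proof.
have rho0' := rho0; move=> WY Y0 yY; rewrite bump_tail; last by lra.
apply: le_trans WY; case: (ltgtP Y (`|y| - rho)) => [/profile_decr/ltW//| |<-//].
by lra.
Qed.

Hypothesis cap_above : forall s, b <= s <= bump_top -> kappa + eta <= f s.
Hypothesis steep_cap : slopeW b < kappa * rho.
Hypothesis barrierW : forall sg c x : R, sg ^+ 2 = 1 -> W (sg * x + c) < b ->
  barrier_at f eta (fun y => W (sg * y + c)) x.

Lemma near_barrier w1 w2 (x : R) : (\forall y \near x, w1 y = w2 y) ->
  barrier_at f eta w2 x -> barrier_at f eta w1 x.
Proof.
move=> w12 bw v dv ddv vw v01 wv; apply: bw => //.
  by rewrite vw (nbhs_singleton w12).
by near=> y; rewrite -(near w12 y) //; near: y.
Unshelve. all: end_near. Qed.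

Lemma tail_barrier (sg c x : R) : sg ^+ 2 = 1 -> 0 < sg * x + c ->
  barrier_at f eta (fun y => W (sg * y + c)) x.
Proof. by move=> sg2 xc; apply: barrierW => //; rewrite -W0; exact: profile_decr. Qed.

(** The cap meets the tails in convex kinks, because it is steeper there. *)
Lemma bump_barrier (xi x : R) : barrier_at f eta (fun y => bump (y - xi)) x.
Proof.
have rho0' := rho0.
pose cap (y : R) : R := b + kappa / 2 * (rho ^+ 2 - (y - xi) ^+ 2).
pose right (y : R) : R := W (1 * y + (- xi - rho)).
pose left (y : R) : R := W (-1 * y + (xi - rho)).
have capE (y : R) : `|y - xi| <= rho -> bump (y - xi) = cap y by rewrite /bump => ->.
have rightE (y : R) : rho <= y - xi -> bump (y - xi) = right y.
  move=> yr; have y0 : 0 <= y - xi by lra.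
  have E : `|y - xi| = y - xi by rewrite ger0_norm.
  by rewrite bump_tail E // /right; congr W; ring.
have leftE (y : R) : rho <= xi - y -> bump (y - xi) = left y.
  move=> yr; have y0 : y - xi <= 0 by lra.
  have E : `|y - xi| = xi - y by rewrite ler0_norm ?opprB.
  by rewrite bump_tail E // /left; congr W; ring.
have dcap (y : R) : is_derive y 1 cap (- kappa * (y - xi)).
  by derive_by_rules; field.
have dright (y : R) : is_derive y 1 right (- slopeW (right y)).
  have dl : is_derive y 1 (fun y : R => 1 * y + (- xi - rho)) 1 by derive_by_rules.
  by have := is_derive1_comp (f := W) (dW _) dl; rewrite mulr1.
have dleft (y : R) : is_derive y 1 left (slopeW (left y)).
  have dl : is_derive y 1 (fun y : R => -1 * y + (xi - rho)) (-1) by derive_by_rules.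
  by have := is_derive1_comp (f := W) (dW _) dl; rewrite mulrN1 opprK.
have [xr|xr|xr] := ltgtP `|x - xi| rho.
- apply: (@smooth_barrier f eta _ cap (fun y => - kappa * (y - xi)) (- kappa)).
  + have /andP[x1 x2] : - rho < x - xi < rho by rewrite -ltr_norml.
    near=> y; apply: capE; rewrite ler_norml.
    suff /andP[? ?] : (xi - rho < y) && (y < xi + rho) by apply/andP; split; lra.
    by apply/andP; split; near: y; [apply: lt_nbhsr|apply: lt_nbhsl]; lra.
  + by near=> y.
  + by derive_by_rules.
  + rewrite -capE ?(ltW xr) // => _.
    suff /cap_above : b <= bump (x - xi) <= bump_top by lra.
    rewrite bump_le_top andbT /bump (ltW xr) lerDl mulr_ge0 ?divr_ge0 ?(ltW kappa0) //.
    rewrite subr_ge0 -[leLHS]real_normK ?num_real //.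
    by rewrite ler_pXn2r ?nnegrE ?(ltW xr) ?(ltW rho0).
- have [x0|x0] := leP 0 (x - xi).
    rewrite ger0_norm // in xr.
    apply: (@near_barrier _ right); last by apply: tail_barrier; [rewrite expr1n|lra].
    near=> y; apply: rightE.
    suff : rho + xi < y by lra.
    by near: y; apply: lt_nbhsr; lra.
  rewrite ltr0_norm // in xr.
  apply: (@near_barrier _ left); last by apply: tail_barrier; [rewrite sqrrN expr1n|lra].
  near=> y; apply: leftE.
  suff : y < xi - rho by lra.
  by near: y; apply: lt_nbhsl; lra.
- have [x0|x0] := leP 0 (x - xi).
    rewrite ger0_norm // in xr.
    apply: (@kink_barrier f eta _ cap right (- (kappa * rho)) (- slopeW b) x).
    + by have := dcap x; rewrite xr mulNr.
    + have := dright x; rewrite {2}/right (_ : 1 * x + _ = 0) ?W0 //; lra.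
    + by rewrite ltrN2.
    + near=> y => yx; apply: capE; rewrite ler_norml; apply/andP; split; last lra.
      suff : x - rho < y by lra.
      by near: y; apply: lt_nbhsr; lra.
    + by near=> y => yx; apply: rightE; lra.
  rewrite ltr0_norm // in xr.
  apply: (@kink_barrier f eta _ left cap (slopeW b) (kappa * rho) x).
  + have := dleft x; rewrite {2}/left (_ : -1 * x + _ = 0) ?W0 //; lra.
  + by have := dcap x; rewrite mulNr -mulrN xr.
  + by [].
  + by near=> y => yx; apply: leftE; lra.
  + near=> y => yx; apply: capE; rewrite ler_norml; apply/andP; split; first lra.
    suff : y < x + rho by lra.
    by near: y; apply: lt_nbhsl; lra.
Unshelve. all: end_near. Qed.
End Bump.

End Barriers.

(** * Comparison on metric graphs *)

Section Comparison.
Context {R : realType} (G : metric_graph R).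
Implicit Types (f : R -> R) (u : R -> graph_point G -> R) (z : edge G -> R -> R -> R).

Definition jointly_continuous u : Prop := forall e : edge G,
  {within [set tx : R * R | edge_dom e tx.2],
    continuous (fun tx : R * R => u tx.1 (edge_point e tx.2))}.

Lemma cvg_slice (s x : R) : (s', x) @[s' --> s] --> nbhs (s, x).
Proof.
move=> A [/= [B1 B2] [B1s B2x] BA].
suff : \forall t \near s, A (t, x) by [].
near=> t; apply: BA => //=; split; first by near: t.
exact: nbhs_singleton.
Unshelve. all: end_near. Qed.

Lemma edge_time_continuous u (e : edge G) (x : R) :
  jointly_continuous u -> edge_dom e x -> continuous (fun s : R => u s (edge_point e x)).
Proof.
move=> cu xe s; have /subspace_continuousP/(_ (s, x) xe) := cu e.
apply: (@cvg_comp _ _ _ (fun s' : R => (s', x)) _ (nbhs s)).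
move=> A [/= [B1 B2] [B1s B2x] BA].
suff : \forall t \near s, edge_dom e x -> A (t, x) by apply: filterS => t; apply.
near=> t => _; apply: BA => //=; split; first by near: t.
exact: nbhs_singleton.
Unshelve. all: end_near. Qed.

Definition edge_cut (e : edge G) (X : R) : set R :=
  [set x | edge_dom e x /\ x <= X].

Lemma edge_cut_compact (e : edge G) (X : R) : compact (edge_cut e X).
Proof.
have [L LE] : exists L, edge_cut e X = `[0, L].
  case E : (len e) => [l| |].
  - exists (Num.min l X); apply/seteqP; split => x /=.
      by rewrite /edge_cut /edge_dom /= in_itv /= E lee_fin le_min => -[[-> ->] ->].
    rewrite in_itv /= le_min => /andP[? /andP[? ?]].
    by rewrite /edge_cut /edge_dom /= E lee_fin.
  - exists X; apply/seteqP; split => x /=.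
      by rewrite /edge_cut /edge_dom /= in_itv /= => -[[-> _] ->].
    by rewrite in_itv /= => /andP[? ?]; rewrite /edge_cut /edge_dom /= E leey.
  - by have := len_gt0 e; rewrite E.
by rewrite LE; exact: segment_compact.
Qed.

(** Contacts along one edge within a cut form a compact set, so there is a first
    one; the time [t1] is a default for the absence of contacts. *)
Lemma first_edge_contact u (e : edge G) (z : R -> R -> R) (X t0 t1 : R) :
  t0 <= t1 -> jointly_continuous u ->
  continuous (fun tx : R * R => z tx.1 tx.2) ->
  exists tau, [/\ t0 <= tau, tau <= t1,
    forall t x, t0 <= t -> t <= t1 -> edge_cut e X x ->
      u t (edge_point e x) <= z t x -> tau <= t &
    (exists2 x, edge_cut e X x & u tau (edge_point e x) <= z tau x) \/
    tau = t1].
Proof.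
move=> t01 cu cz.
pose K : set (R * R) := `[t0, t1] `*` edge_cut e X.
have Kc : compact K by apply: compact_setX; [exact: segment_compact|exact: edge_cut_compact].
pose d (tx : R * R) := u tx.1 (edge_point e tx.2) - z tx.1 tx.2.
have dc : {within K, continuous d}.
  have Ksub : K `<=` [set tx : R * R | edge_dom e tx.2] by move=> [t x] /= [_ []].
  have uc := continuous_subspaceW Ksub (cu e).
  have zc : {within K, continuous (fun tx : R * R => z tx.1 tx.2)}.
    exact: continuous_subspaceT.
  by move=> tx; apply: cvgB; [exact: uc|exact: zc].
pose B : set (R * R) := K `&` [set tx | d tx <= 0].
have Bc : compact B.
  have : closed ([set tx | d tx <= 0] : set (subspace K)).
    have /continuous_closedP/(_ [set y : R | y <= 0]) := dc.
    by apply; exact: closed_le.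
  move=> /closed_subspaceP[V Vc VE].
  have -> : B = V `&` K by rewrite VE setIC.
  apply: (subclosed_compact _ Kc); last exact: subIsetr.
  by apply: closedI => //; apply: compact_closed => //; exact: norm_hausdorff.
have [[tx0 Btx0]|nB] := pselect (B !=set0); last first.
  exists t1; split=> // [t x ? ? xe|].
    move=> uz; exfalso; apply: nB; exists (t, x); split; last by rewrite /= subr_le0.
    by split => //=; rewrite in_itv /=; apply/andP.
  by right.
have fc : {within B, continuous (fst : R * R -> R)}.
  by apply: continuous_subspaceT => tx; exact: cvg_fst.
have [[tau x] Btx minB] := compact_EVT_min (ex_intro _ tx0 Btx0) Bc fc.
move: Btx; rewrite inE => -[[/=]]; rewrite in_itv /= => /andP[tau0 tau1] xe dle.
exists tau; split => // [t y ? ? ye uz|].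
  apply: (minB (t, y)); rewrite inE; split; last by rewrite /= subr_le0.
  by split => //=; rewrite in_itv /=; apply/andP.
by left; exists x => //; move: dle; rewrite /d /= subr_le0.
Qed.

(** At the first time of contact [z] touches [u] from below, which the last
    hypothesis forbids; the third one confines contacts to bounded parts of the
    half lines, so that a first time exists. *)
Lemma comparison u z (t0 : R) : jointly_continuous u ->
  (forall e, continuous (fun tx : R * R => z e tx.1 tx.2)) ->
  (forall e t1, exists X, forall t x, t0 <= t -> t <= t1 -> edge_dom e x ->
     X < x -> z e t x < u t (edge_point e x)) ->
  (forall e x, edge_dom e x -> z e t0 x < u t0 (edge_point e x)) ->
  (forall e t x, t0 < t -> edge_dom e x ->
     (forall e' x', edge_dom e' x' -> z e' t x' <= u t (edge_point e' x')) ->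
     (forall s, t0 <= s -> s < t -> z e s x < u s (edge_point e x)) ->
     u t (edge_point e x) = z e t x -> False) ->
  forall t e x, t0 <= t -> edge_dom e x -> z e t x < u t (edge_point e x).
Proof.
move=> cu cz far init notouch t1 e1 x1 t01 x1e.
rewrite ltNge; apply/negP => bad.
have [X HX] := choice (fun e => far e t1).
have [tau Htau] := choice (fun e =>
  @first_edge_contact u e (z e) (X e) t0 t1 t01 cu (cz e)).
have good e t x : t0 <= t -> t < tau e -> t <= t1 -> edge_dom e x ->
    z e t x < u t (edge_point e x).
  move=> t0t tt tt1 xe; have [xX|xX] := leP x (X e); last exact: HX.
  have [_ _ H _] := Htau e; rewrite ltNge; apply/negP => uz.
  by have := H t x t0t tt1 (conj xe xX) uz; rewrite leNgt tt.
pose m := [arg min_(e < e1) tau e]%O.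
have mmin e : tau m <= tau e.
  by rewrite /m; case: arg_minP => // i _ + ; apply.
have [m0 m1 _ contact] := Htau m.
have contact1 : forall e x t, t0 <= t -> t < tau m -> edge_dom e x ->
    z e t x < u t (edge_point e x).
  move=> e x t t0t tm xe; apply: good => //; first exact: lt_le_trans (mmin e).
  by apply: ltW; exact: lt_le_trans m1.
(* In the default case, where [tau m = t1], the assumed contact [bad] serves. *)
have [em [xm [xme badm]]] : exists em xm,
    edge_dom em xm /\ u (tau m) (edge_point em xm) <= z em (tau m) xm.
  case: contact => [[x [xe _] ux]|->]; first by exists m, x.
  by exists e1, x1.
have m_gt : t0 < tau m.
  rewrite lt_neqAle m0 andbT; apply/negP => /eqP E.
  by move: badm; rewrite -E leNgt (init _ _ xme).
have contact0 : forall e x, edge_dom e x -> z e (tau m) x <= u (tau m) (edge_point e x).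
  move=> e x xe; rewrite leNgt; apply/negP => lt.
  have : \forall s \near tau m, u s (edge_point e x) - z e s x < 0.
    have cz1 : z e s x @[s --> tau m] --> z e (tau m) x.
      apply: (@cvg_comp _ _ _ (fun s : R => (s, x)) (fun tx => z e tx.1 tx.2)
        _ _ _ _ (cz e (tau m, x))).
      exact: cvg_slice.
    have H : u s (edge_point e x) - z e s x @[s --> tau m] -->
        u (tau m) (edge_point e x) - z e (tau m) x.
      by apply: cvgB cz1; exact: (@edge_time_continuous u e x cu xe (tau m)).
    by apply: (cvgr_lt _ H); rewrite subr_lt0.
  move=> /nbhs_ballP[r /= r0 Hr].
  pose h := Num.min r (tau m - t0) / 2.
  have h0 : 0 < Num.min r (tau m - t0) by rewrite lt_min r0 subr_gt0.
  have hr : Num.min r (tau m - t0) <= r by rewrite ge_min lexx.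
  have ht : Num.min r (tau m - t0) <= tau m - t0 by rewrite ge_min lexx orbT.
  have := Hr (tau m - h); rewrite /ball /= subKr gtr0_norm; last by rewrite /h; lra.
  move=> /(_ ltac:(rewrite /h; lra)); rewrite subr_lt0 ltNge => /negP; apply.
  by apply: ltW; apply: contact1 => //; rewrite /h; lra.
apply: (notouch em (tau m) xm) => //; first by move=> s ? ?; exact: contact1.
by apply/eqP; rewrite eq_le badm contact0.
Qed.

(** At an interior contact the barrier forces [u_t >= eta], so [u] was below
    [z], which moves at speed less than [eta], just before. *)
Lemma no_interior_contact f u (z : R -> R -> R) (e : edge G) (eta k t0 t x : R) :
  entire_solution f u -> (forall t p, points G p -> 0 < u t p < 1) ->
  barrier_at f eta (z t) x -> k < eta ->
  (forall s, s < t -> z t x - k * (t - s) <= z s x) ->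
  t0 < t -> 0 < x -> (x%:E < len e)%E ->
  (forall x', edge_dom e x' -> z t x' <= u t (edge_point e x')) ->
  (forall s, t0 <= s -> s < t -> z s x < u s (edge_point e x)) ->
  u t (edge_point e x) = z t x -> False.
Proof.
move=> [_ pde _ _] u01 bz keta zk t0t x0 xe above before eq.
have near_in : \forall y \near x, 0 < y /\ (y%:E < len e)%E.
  have near_lt : \forall y \near x, (y%:E < len e)%E.
    move: xe; case E : (len e) => [l| |] //=.
    - by rewrite lte_fin => xl; near=> y; rewrite lte_fin; near: y; exact: lt_nbhsl.
    - by move=> _; near=> y; rewrite ltry.
  near=> y; split; near: y => //; exact: lt_nbhsr.
pose v := u t \o edge_point e.
have [_ ddv dut] := pde e t x x0 xe.
have xv01 : 0 < v x < 1.
  apply: u01; rewrite /edge_point gt_eqF //; by case: ifPn.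
have dv : \forall y \near x, derivable v (y : R) 1.
  by apply: filterS near_in => y [y0 ye]; have [] := pde e t y y0 ye.
have zv : \forall y \near x, z t y <= v y.
  apply: filterS near_in => y [y0 ye]; apply: above.
  by split; rewrite ltW.
have := bz v dv ddv eq xv01 zv; rewrite -/v in dut *.
set D := _ + _ in dut * => etaD.
have dl : is_derive t 1 (fun s => k * s - u s (edge_point e x)) (k - D).
  by derive_by_rules.
have [|r r0 Hr] := derive_neg_growth dl; first by rewrite subr_lt0; lra.
pose h := Num.min r (t - t0) / 2.
have h0 : 0 < Num.min r (t - t0) by rewrite lt_min r0 subr_gt0.
have hr : Num.min r (t - t0) <= r by rewrite ge_min lexx.
have ht : Num.min r (t - t0) <= t - t0 by rewrite ge_min lexx orbT.
have hh : 0 < h by rewrite /h; lra.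
have := Hr (- h); rewrite normrN gtr0_norm // => /(_ hh ltac:(rewrite /h; lra)).
rewrite invrN mulNr oppr_lt0 pmulr_rgt0 ?invr_gt0 // eq.
have := @before (t - h) ltac:(rewrite /h; lra) ltac:(rewrite /h; lra).
have := @zk (t - h) ltac:(rewrite /h; lra).
by rewrite subKr; lra.
Unshelve. all: end_near. Qed.

Lemma is_derive_edge_quotient (z : R -> R) (x p : R) : is_derive x 1 z p ->
  edge_quotient z x y @[y --> x^'] --> p.
Proof.
move=> /is_derive1_caratheodory[h [hE hc <-]].
have : h y @[y --> x^'] --> h x by apply: cvg_within_filter; exact: hc.
apply: cvg_trans; apply: near_eq_cvg; near=> y.
rewrite /edge_quotient hE mulfK // subr_eq0.
by near: y; exact: nbhs_dnbhs_neq.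
Unshelve. all: end_near. Qed.

Lemma edge_dom0 (e : edge G) : edge_dom e 0.
Proof. by split => //; rewrite ltW // len_gt0. Qed.

Lemma edge_dom_end (e : edge G) : len e != +oo%E -> edge_dom e (fine (len e)).
Proof.
move=> le; have l0 := len_gt0 e.
have le' : len e \is a fin_num by rewrite ge0_fin_numE ?(ltW l0) // ltey.
by split; [rewrite fine_ge0 // ltW|rewrite fineK].
Qed.

Lemma edge_ends_filter (e : edge G) (x y : R) : edge_dom e x -> edge_dom e y ->
  x != y -> ProperFilter (within (edge_dom e) x^').
Proof.
move=> [x0 xe] [y0 ye] xy; apply: Build_ProperFilter_ex => B.
rewrite /within /= near_withinE => /nbhs_ballP[r /= r0 Hr].
have d0 : 0 < `|y - x| by rewrite normr_gt0 subr_eq0 eq_sym.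
pose h := Num.min 1 (r / (2 * `|y - x|)).
have h0 : 0 < h by rewrite lt_min ltr01 divr_gt0 // mulr_gt0.
have h1 : h <= 1 by rewrite ge_min lexx.
have hr : h * `|y - x| < r.
  have : h * `|y - x| <= r / (2 * `|y - x|) * `|y - x|.
    by rewrite ler_wpM2r // ge_min lexx orbT.
  have -> : r / (2 * `|y - x|) * `|y - x| = r / 2 by field; rewrite gt_eqF.
  by move=> /le_lt_trans; apply; lra.
exists (x + h * (y - x)); apply: Hr => /=.
- by rewrite /ball /= opprD addrA subrr sub0r normrN normrM gtr0_norm.
- rewrite eq_sym -subr_eq0 opprD addrA subrr sub0r oppr_eq0.
  by rewrite mulf_neq0 ?(gt_eqF h0) // subr_eq0 eq_sym.
- have -> : x + h * (y - x) = (1 - h) * x + h * y by ring.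
  split; first by rewrite addr_ge0 // mulr_ge0 // ?subr_ge0 // ltW.
  case: (len e) xe ye => [l| |] //=; last by rewrite !leey.
  rewrite !lee_fin => xl yl.
  have -> : l = (1 - h) * l + h * l by ring.
  by rewrite lerD // ler_wpM2l // ?subr_ge0 // ltW.
Qed.

Lemma edge_derive_ge (e : edge G) (w z : R -> R) (p : R) (y : R) :
  edge_dom e y -> 0 < y -> edge_derivable e w 0 -> is_derive (0 : R) 1 z p -> w 0 = z 0 ->
  (forall x, edge_dom e x -> z x <= w x) -> p <= edge_derive e w 0.
Proof.
move=> ye y0 dw dz eq zw.
have FF := edge_ends_filter (edge_dom0 e) ye (negbT (lt_eqF y0)).
have zc : edge_quotient z 0 y @[y --> within (edge_dom e) 0^'] --> p.
  by apply: cvg_within_filter; exact: is_derive_edge_quotient.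
apply: (ler_cvg_to zc dw).
near=> x.
have xe : edge_dom e x by near: x; exact: withinT.
have x0 : 0 < x.
  have [xge _] := xe; rewrite lt_neqAle xge andbT eq_sym.
  by near: x; apply: cvg_within; exact: (@nbhs_dnbhs_neq R).
rewrite /edge_quotient eq; apply: ler_wpM2r; first by rewrite invr_ge0 subr0 ltW.
by apply: lerB => //; exact: zw.
Unshelve. all: end_near. Qed.

Lemma edge_derive_le (e : edge G) (w z : R -> R) (q : R) : len e != +oo%E ->
  edge_derivable e w (fine (len e)) -> is_derive (fine (len e)) 1 z q ->
  w (fine (len e)) = z (fine (len e)) ->
  (forall x, edge_dom e x -> z x <= w x) -> edge_derive e w (fine (len e)) <= q.
Proof.
move=> le dw dz eq zw.
have l0 := len_gt0 e.
have lfin : len e \is a fin_num by rewrite ge0_fin_numE ?(ltW l0) // ltey.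
have L0 : 0 < fine (len e) by rewrite fine_gt0 // l0 ltey.
have FF := edge_ends_filter (edge_dom_end le) (edge_dom0 e) (negbT (gt_eqF L0)).
have zc : edge_quotient z (fine (len e)) y @[y --> within (edge_dom e) (fine (len e))^'] --> q.
  by apply: cvg_within_filter; exact: is_derive_edge_quotient.
apply: (ler_cvg_to dw zc).
near=> x.
have xe : edge_dom e x by near: x; exact: withinT.
have xL : x < fine (len e).
  have [_ xle] := xe; rewrite lt_neqAle -lee_fin fineK // xle andbT.
  by near: x; apply: cvg_within; exact: (@nbhs_dnbhs_neq R).
rewrite /edge_quotient eq; apply: ler_wnM2r; first by rewrite invr_le0 subr_le0 ltW.
by apply: lerB => //; exact: zw.
Unshelve. all: end_near. Qed.

Lemma edge_point_end (e : edge G) : len e != +oo%E ->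
  edge_point e (fine (len e)) = Vertex (tgt e).
Proof.
move=> le; have l0 := len_gt0 e.
have lfin : len e \is a fin_num by rewrite ge0_fin_numE ?(ltW l0) // ltey.
have L0 : 0 < fine (len e) by rewrite fine_gt0 // l0 ltey.
by rewrite /edge_point gt_eqF // fineK // eqxx.
Qed.

(** The outward slopes of [w] dominate those of [z] at a contact, whereas they
    add up to [0]. *)
Lemma no_vertex_contact (w : graph_point G -> R) (z : edge G -> R -> R)
    (p q : edge G -> R) (v : vertex G) :
  kirchhoff w ->
  (forall e x, edge_dom e x -> edge_derivable e (w \o edge_point e) x) ->
  (forall e, src e = v -> is_derive (0 : R) 1 (z e) (p e)) ->
  (forall e, len e != +oo%E -> tgt e = v -> is_derive (fine (len e)) 1 (z e) (q e)) ->
  (forall e, src e = v -> z e 0 = w (Vertex v)) ->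
  (forall e, len e != +oo%E -> tgt e = v -> z e (fine (len e)) = w (Vertex v)) ->
  (forall e x, edge_dom e x -> z e x <= w (edge_point e x)) ->
  0 < \sum_(e : edge G | src e == v) p e +
      \sum_(e : edge G | (len e != +oo%E) && (tgt e == v)) - q e -> False.
Proof.
move=> kw dw dp dq zp zq zw; rewrite ltNge => /negP; apply.
rewrite -[leRHS](kw v) /outgoing_flux; apply: lerD; apply: ler_sum => e.
  move=> /eqP ev.
  have [y ye y0] : exists2 y : R, edge_dom e y & 0 < y.
    have := len_gt0 e; case E : (len e) => [l| |] // l0.
      by exists l => //; split; rewrite ?E // ltW.
    by exists 1 => //; split; rewrite ?E ?leey.
  apply: (@edge_derive_ge e _ (z e) (p e) y) => //.
  - by apply: dw; exact: edge_dom0.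
  - exact: dp.
  - by rewrite zp //= /edge_point eqxx ev.
  - by move=> x; exact: zw.
move=> /andP[le /eqP ev]; rewrite lerN2.
apply: (@edge_derive_le e _ (z e)) => //.
- by apply: dw; exact: edge_dom_end.
- exact: dq.
- by rewrite zq //= edge_point_end // ev.
- by move=> x; exact: zw.
Qed.

End Comparison.

(** * A Poisson problem on the center graph *)

Section Poisson.
Context {R : realType} (D : metric_graph R).
Hypothesis bounded_D : bounded_graph D.
Implicit Types (h : vertex D -> R).

Let L (e : edge D) : R := fine (len e).
Let d h (e : edge D) : R := h (tgt e) - h (src e).

Lemma edge_length_gt0 e : 0 < L e.
Proof. by rewrite fine_gt0 // len_gt0 /= ltey_eq (bounded_D e). Qed.

Lemma edge_length_neq0 e : L e != 0.
Proof. by rewrite gt_eqF // edge_length_gt0. Qed.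

Definition laplacian h (v : vertex D) : R :=
  \sum_(e | src e == v) d h e / L e - \sum_(e | tgt e == v) d h e / L e.

Lemma sum_laplacian (g : vertex D -> R) h :
  \sum_v g v * laplacian h v = - \sum_e d g e * d h e / L e.
Proof.
transitivity (\sum_e g (src e) * (d h e / L e) - \sum_e g (tgt e) * (d h e / L e)).
  rewrite (partition_big src xpredT) //= [X in _ = _ - X](partition_big tgt xpredT) //=.
  rewrite -sumrB; apply: eq_bigr => v _.
  rewrite mulrBr !mulr_sumr; congr (_ - _).
    by apply: eq_bigr => e /eqP ->.
  by apply: eq_bigr => e /eqP ->.
rewrite -sumrB -sumrN; apply: eq_bigr => e _.
by rewrite /d; ring.
Qed.

Lemma sum_laplacian0 h : \sum_v laplacian h v = 0.
Proof.
have := sum_laplacian (fun=> 1) h.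
under eq_bigr do rewrite mul1r.
move=> ->; rewrite big1 ?oppr0 // => e _.
by rewrite /d subrr mul0r mul0r.
Qed.

(** Along a path without repeated vertices, each edge is used at most once. *)
Lemma oscillation_le h (v w : vertex D) : `|h v - h w| <= \sum_e `|d h e|.
Proof.
have /connectP[p0 path0 ->] := graph_connected v w.
case: (shortenP path0) => p pathp uniqp _ {p0 path0}.
apply: (@le_trans _ _ (\sum_(e | (src e \in v :: p) && (tgt e \in v :: p)) `|d h e|)); last first.
  by rewrite [leRHS](bigID (fun e => (src e \in v :: p) && (tgt e \in v :: p))) /= lerDl sumr_ge0.
elim: p v pathp uniqp => [v _ _|x p IH v /=].
  by rewrite /= subrr normr0 sumr_ge0.
move=> /andP[/existsP[e0 /andP[_ je0]] pathp] /andP[vp uniqp].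
have {}IH := IH x pathp uniqp.
have hd : `|h v - h x| = `|d h e0|.
  by case/orP: je0 => /andP[/eqP <- /eqP <-]; rewrite /d // distrC.
have e0_in : (src e0 \in v :: x :: p) && (tgt e0 \in v :: x :: p).
  by case/orP: je0 => /andP[/eqP -> /eqP ->]; rewrite !inE !eqxx ?orbT.
have e0_out : ~~ ((src e0 \in x :: p) && (tgt e0 \in x :: p)).
  by case/orP: je0 => /andP[/eqP -> /eqP ->]; rewrite (negbTE vp) ?andbF.
rewrite (bigD1 e0) //= -hd.
have -> : h v - h (last x p) = (h v - h x) + (h x - h (last x p)) by ring.
apply: le_trans (ler_normD _ _) _; rewrite lerD2l.
apply: le_trans IH _.
rewrite big_mkcond [leRHS]big_mkcond /=; apply: ler_sum => e _.
case: ifPn => [/andP[se te]|_]; last by case: ifP.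
rewrite !inE in se te *; rewrite se te !orbT /=.
case: eqP => // ee0; exfalso.
by move: e0_out; rewrite -ee0 !inE se te.
Qed.

(** The energy identity makes the Laplacian injective up to constants; adding the
    sum of the values makes it invertible. *)
Lemma laplacian_solvable (c : vertex D -> R) : \sum_v c v = 0 ->
  exists h, forall v, laplacian h v = c v.
Proof.
move=> c0.
pose phi (h : {ffun vertex D -> R^o}) : {ffun vertex D -> R^o} :=
  [ffun v => laplacian h v + \sum_w h w].
have phi_lin : linear phi.
  move=> k g h; apply/ffunP => v; rewrite !ffunE.
  have -> : \sum_w (k *: g + h) w = k * (\sum_w g w) + \sum_w h w.
    by rewrite mulr_sumr -big_split; apply: eq_bigr => w _; rewrite !ffunE.
  have -> : laplacian (k *: g + h) v = k * laplacian g v + laplacian h v.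
    rewrite /laplacian mulrBr addrACA -opprD; congr (_ - _);
      rewrite mulr_sumr -big_split /=; apply: eq_bigr => e _;
      by rewrite /d !ffunE /GRing.scale /=; ring.
  by rewrite /GRing.scale /=; ring.
pose phiL : {linear {ffun vertex D -> R^o} -> {ffun vertex D -> R^o}} :=
  HB.pack phi (GRing.isLinear.Build _ _ _ _ phi phi_lin).
have sum_phi (h : {ffun vertex D -> R^o}) : \sum_v phi h v = #|vertex D|%:R * \sum_w h w.
  under eq_bigr do rewrite ffunE.
  by rewrite big_split /= sum_laplacian0 add0r sumr_const mulr_natl.
have card_gt0 (v : vertex D) : #|vertex D|%:R != 0 :> R.
  by rewrite pnatr_eq0 -lt0n; apply/card_gt0P; exists v.
have mean0 (h : {ffun vertex D -> R^o}) (v : vertex D) :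
    \sum_v phi h v = 0 -> \sum_w h w = 0.
  by rewrite sum_phi => /eqP; rewrite mulf_eq0 (negbTE (card_gt0 v)) => /eqP.
have ker0 : lker (linfun phiL) == 0%VS.
  apply/lker0P => g1 g2; rewrite !lfunE /= => eqphi.
  apply/eqP; rewrite -subr_eq0; apply/eqP; set h := g1 - g2.
  have ph0 : phi h = 0.
    by rewrite -[phi]/(phiL : _ -> _) linearB /= eqphi subrr.
  apply/ffunP => v; rewrite [RHS]ffunE.
  have h0 : \sum_w h w = 0.
    by apply: mean0 => //; rewrite ph0 big1 // => w _; rewrite ffunE.
  have lap0 w : laplacian h w = 0.
    by have := congr1 (fun g : {ffun vertex D -> R^o} => g w) ph0; rewrite !ffunE h0 addr0.
  have d0 e : d h e = 0.
    have := sum_laplacian h h; rewrite big1; last by move=> w _; rewrite lap0 mulr0.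
    move=> /eqP; rewrite eq_sym oppr_eq0 psumr_eq0; last first.
      by move=> e' _; rewrite -expr2 divr_ge0 ?sqr_ge0 // ltW // edge_length_gt0.
    move=> /allP/(_ e); rewrite mem_index_enum => /(_ isT)/=.
    rewrite mulf_eq0 invr_eq0 (negbTE (edge_length_neq0 e)) orbF -expr2 sqrf_eq0.
    by move=> /eqP.
  have const w : h w = h v.
    apply/eqP; rewrite -subr_eq0 -normr_le0.
    by apply: le_trans (oscillation_le h w v) _; rewrite big1 // => e _; rewrite d0 normr0.
  move: h0; under eq_bigr do rewrite const.
  by rewrite sumr_const -mulr_natl => /eqP; rewrite mulf_eq0 (negbTE (card_gt0 v)) => /eqP.
pose cf : {ffun vertex D -> R^o} := [ffun v => c v].
exists ((linfun phiL)^-1%VF cf) => v.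
set h := (_^-1)%VF cf.
have hE : phi h = cf.
  by have := lker0_lfunVK ker0 cf; rewrite lfunE.
have h0 : \sum_w h w = 0.
  by apply: mean0 => //; rewrite hE -[RHS]c0; apply: eq_bigr => w _; rewrite ffunE.
by have := congr1 (fun g : {ffun vertex D -> R^o} => g v) hE; rewrite !ffunE h0 addr0.
Qed.

(** The fluxes of a function with constant second derivative [k] on the edges form
    a linear system for its values at the vertices.  The bound comes from the
    energy identity: with [S] the sum of the [`|d h e|], the energy is at most
    [S * B], and [`|d h e| <= (d h e) ^+ 2 / L e / (2 * B) + B * L e / 2], whence
    [S <= B * \sum_e L e]. *)
Lemma graph_poisson (b : vertex D -> R) (k B : R) (v0 : vertex D) : 0 < B ->
  \sum_v b v = - (k * \sum_e L e) ->
  \sum_v `|b v| + `|k| * \sum_e L e <= B ->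
  exists h, (forall v,
      \sum_(e | src e == v) (d h e / L e - k / 2 * L e) +
      \sum_(e | tgt e == v) - (d h e / L e + k / 2 * L e) = b v) /\
    (forall v, `|h v| <= B * \sum_e L e).
Proof.
move=> B0 sumb bB.
(* At either end of [e], the outward slope of the solution of [w'' = k] is that of
   the affine function with the same boundary values minus [k / 2 * L e]. *)
pose c v := b v + k / 2 * (\sum_(e | src e == v) L e + \sum_(e | tgt e == v) L e).
have sumL : \sum_v (\sum_(e | src e == v) L e + \sum_(e | tgt e == v) L e) = 2 * \sum_e L e.
  rewrite big_split /= mulr2n mulrDl !mul1r.
  congr (_ + _); first by rewrite [RHS](partition_big src xpredT).
  by rewrite [RHS](partition_big tgt xpredT).
have sumc : \sum_v c v = 0.
  by rewrite big_split /= sumb -mulr_sumr sumL; field.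
have [h0 lap0] := laplacian_solvable sumc.
pose h v := h0 v - h0 v0.
have dE e : d h e = d h0 e by rewrite /d /h; ring.
have lap v : laplacian h v = c v.
  rewrite -lap0 /laplacian; congr (_ - _); apply: eq_bigr => e _; by rewrite dE.
have normc : \sum_v `|c v| <= B.
  apply: le_trans bB.
  have -> : `|k| * \sum_e L e = \sum_v (`|k| / 2 *
      (\sum_(e | src e == v) L e + \sum_(e | tgt e == v) L e)).
    by rewrite -mulr_sumr sumL; field.
  rewrite -big_split /=; apply: ler_sum => v _.
  apply: le_trans (ler_normD _ _) _; rewrite lerD2l normrM normrM.
  have half0 : 0 <= 2^-1 :> R by rewrite invr_ge0.
  have sum0 : 0 <= \sum_(e | src e == v) L e + \sum_(e | tgt e == v) L e.
    by rewrite addr_ge0 // sumr_ge0 // => e _; rewrite ltW // edge_length_gt0.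
  by rewrite (ger0_norm half0) (ger0_norm sum0).
pose S := \sum_e `|d h e|.
have hS v : `|h v| <= S.
  by have := oscillation_le h v v0; rewrite {2}/h subrr subr0.
have energy : \sum_e (d h e) ^+ 2 / L e <= S * B.
  have -> : \sum_e (d h e) ^+ 2 / L e = - \sum_v h v * laplacian h v.
    by rewrite sum_laplacian opprK; apply: eq_bigr => e _; rewrite expr2.
  rewrite -sumrN; apply: (@le_trans _ _ (\sum_v S * `|c v|)).
    apply: ler_sum => v _; rewrite lap; apply: le_trans (ler_norm _) _.
    by rewrite normrN normrM ler_wpM2r.
  by rewrite -mulr_sumr ler_wpM2l // sumr_ge0.
have SB : S <= B * \sum_e L e.
  have amgm e : `|d h e| <= (d h e) ^+ 2 / L e / (2 * B) + B * L e / 2.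
    have L0 := edge_length_gt0 e.
    have -> : (d h e) ^+ 2 / L e / (2 * B) + B * L e / 2 =
       `|d h e| + (`|d h e| - B * L e) ^+ 2 / (2 * B * L e).
      rewrite -[in LHS](real_normK (num_real (d h e))); field.
      by rewrite edge_length_neq0 gt_eqF.
    by rewrite lerDl divr_ge0 ?sqr_ge0 // !mulr_ge0 // ltW.
  have : S <= (\sum_e (d h e) ^+ 2 / L e) / (2 * B) + B * (\sum_e L e) / 2.
    rewrite mulr_suml mulr_sumr mulr_suml -big_split /=.
    by apply: ler_sum => e _; exact: amgm.
  have : (\sum_e (d h e) ^+ 2 / L e) / (2 * B) <= S / 2.
    rewrite ler_pdivrMr ?mulr_gt0 //; apply: le_trans energy _.
    by rewrite mulrA divfK.
  by lra.
exists h; split=> v; last exact: le_trans (hS v) SB.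
transitivity (laplacian h v - k / 2 * (\sum_(e | src e == v) L e + \sum_(e | tgt e == v) L e)).
  rewrite sumrB sumrN big_split /= -!mulr_sumr /laplacian; ring.
by rewrite lap /c; ring.
Qed.

End Poisson.

(** * Energy profiles of a bistable nonlinearity *)

Section Energies.
Context {R : realType}.
Implicit Types (f g W psi F : R -> R).

Lemma derive_ge0_le F (dF : R -> R) (x y : R) :
  (forall s : R, is_derive s 1 F (dF s)) -> x <= y ->
  (forall s, x < s -> s < y -> 0 <= dF s) -> F x <= F y.
Proof.
move=> dFs; rewrite le_eqVlt => /predU1P[->//|xy] dF0.
have [z + E] := MVT xy (fun z _ => dFs z) (is_derive_within_continuous dFs).
rewrite in_itv /= => /andP[xz zy].
by rewrite -subr_ge0 E mulr_ge0 ?dF0 // subr_ge0 ltW.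
Qed.

Lemma primitive0 f : primitive f 0 = 0.
Proof. by rewrite /primitive lexx set_itv1 Rintegral_set1. Qed.

Definition positive_part f (s : R) : R := Num.max (f s) 0.

Section Bistable.
Variables (f : R -> R) (a : R).
Hypothesis bi : bistable f a.
Let F := primitive f.
Let Fp := primitive (positive_part f).

Lemma bistable_continuous : continuous f.
Proof.
have [[df _] _ _ _ _] := bi.
by move=> x; apply: differentiable_continuous; apply/derivable1_diffP.
Qed.

Lemma positive_part_continuous : continuous (positive_part f).
Proof.
move=> x; apply: continuous_max; last exact: cvg_cst.
exact: bistable_continuous.
Qed.

Lemma is_derive_energy (s : R) : is_derive s 1 F (f s).
Proof. by apply: is_derive_primitive; exact: bistable_continuous. Qed.

Lemma is_derive_positive_energy (s : R) : is_derive s 1 Fp (positive_part f s).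
Proof. by apply: is_derive_primitive; exact: positive_part_continuous. Qed.

Lemma bistable_nodes : [/\ 0 < a, a < 1,
  forall s, 0 < s -> s < a -> f s < 0 & forall s, a < s -> s < 1 -> 0 < f s].
Proof.
have [_ /andP[a0 a1] _ [fn fp] _] := bi.
split=> // s s1 s2; [apply: fn|apply: fp]; exact/andP.
Qed.

Lemma energy_nincr (s t : R) : 0 <= s -> s <= t -> t <= a -> F t <= F s.
Proof.
move=> s0 st ta; have [a0 a1 fn fp] := bistable_nodes.
have dNF (x : R) : is_derive x 1 (fun x => - F x) (- f x).
  by have := is_derive_energy x => ?; exact: is_deriveN.
rewrite -lerN2; apply: (derive_ge0_le dNF st) => x sx xt.
by rewrite oppr_ge0 ltW // fn; lra.
Qed.

Lemma energy_ndecr (s t : R) : a <= s -> s <= t -> t <= 1 -> F s <= F t.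
Proof.
move=> s0 st ta; have [a0 a1 fn fp] := bistable_nodes.
apply: (derive_ge0_le is_derive_energy st) => x sx xt.
by rewrite ltW // fp; lra.
Qed.

Lemma energy_le0 (s : R) : 0 <= s -> s <= a -> F s <= 0.
Proof. by move=> s0 sa; rewrite -(primitive0 f); exact: energy_nincr. Qed.

Lemma positive_energyE (s : R) : 0 <= s -> s <= 1 ->
  Fp s = if s <= a then 0 else F s - F a.
Proof.
have [a0 a1 fn fp] := bistable_nodes.
have dNFp (x : R) : is_derive x 1 (fun x => - Fp x) (- positive_part f x).
  by have := is_derive_positive_energy x => ?; exact: is_deriveN.
have low t : 0 <= t -> t <= a -> Fp t = 0.
  move=> t0 ta; apply/eqP; rewrite eq_le -[leRHS](primitive0 (positive_part f)).
  rewrite -{2}(primitive0 (positive_part f)) -lerN2.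
  have z x : 0 < x -> x < t -> positive_part f x = 0.
    by move=> x0 xt; rewrite /positive_part max_r // ltW // fn //; lra.
  apply/andP; split.
    by apply: (derive_ge0_le dNFp t0) => x x0 xt; rewrite z ?oppr0.
  by apply: (derive_ge0_le is_derive_positive_energy t0) => x x0 xt; rewrite z.
move=> s0 s1; case: ifPn => [sa|]; first exact: low.
rewrite -ltNge => sa.
have d1 (x : R) : is_derive x 1 (fun x => F x - Fp x) (f x - positive_part f x).
  by have := is_derive_positive_energy x; have := is_derive_energy x => ? ?; exact: is_deriveB.
have d2 (x : R) : is_derive x 1 (fun x => Fp x - F x) (positive_part f x - f x).
  by have := is_derive_positive_energy x; have := is_derive_energy x => ? ?; exact: is_deriveB.
have z x : a < x -> x < s -> positive_part f x = f x.
  by move=> ax xs; rewrite /positive_part max_l // ltW // fp //; lra.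
have H1 : Fp a - F a <= Fp s - F s.
  by apply: (derive_ge0_le d2 (ltW sa)) => x ax xs; rewrite z // subrr.
have H2 : F a - Fp a <= F s - Fp s.
  by apply: (derive_ge0_le d1 (ltW sa)) => x ax xs; rewrite z // subrr.
by have := low a (ltW a0) (lexx a); lra.
Qed.

Lemma energy_near_left (lo y c : R) : lo < y -> 0 < F y + c ->
  exists x, [/\ lo < x, x < y & 0 < F x + c].
Proof.
move=> loy Fy.
have cF := is_derive_continuous is_derive_energy.
have : \forall x \near y, 0 < F x + c.
  have H : (F x + c) @[x --> y] --> F y + c by apply: cvgD; [exact: cF|exact: cvg_cst].
  exact: (cvgr_gt _ H).
move=> /nbhs_ballP[r /= r0 Hr].
have m0 : 0 < Num.min r (y - lo) by rewrite lt_min r0 subr_gt0.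
have mr : Num.min r (y - lo) <= r by rewrite ge_min lexx.
have ml : Num.min r (y - lo) <= y - lo by rewrite ge_min lexx orbT.
exists (y - Num.min r (y - lo) / 2); split; [lra|lra|].
by apply: Hr; rewrite /ball /= subKr gtr0_norm; lra.
Qed.

End Bistable.

(** [W] is a branch of an orbit in the phase plane, followed downwards from the
    height [b]; [psi] gives the position of a height on it, by which barriers are
    matched at the vertices. *)
Definition profile f (b eta : R) g W psi : Prop :=
  [/\ W 0 = b, cancel W psi, cancel psi W,
    forall x : R, is_derive x 1 W (- g (W x)) &
    forall s : R, is_derive s 1 psi (- (g s)^-1)] /\
  forall sg c x : R, sg ^+ 2 = 1 -> W (sg * x + c) < b ->
    barrier_at f eta (fun y => W (sg * y + c)) x.

Definition tame_slope g (gmin gmax k : R) : Prop :=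
  [/\ 0 < gmin, 0 < k, forall s, gmin <= g s, forall s, g s <= gmax &
    forall s t, `|g s - g t| <= k * `|s - t|].

Lemma energy_profile f (A A' : R -> R) (b eta : R) : 0 < b -> 0 < eta ->
  (forall s : R, is_derive s 1 A (A' s)) -> continuous A' ->
  (forall s : R, 0 <= s <= b -> eta <= A s) ->
  (forall s : R, 0 <= s <= b -> eta <= A' s + f s) ->
  (exists gmin gmax k, tame_slope (slope A b) gmin gmax k) /\
  exists W psi, profile f b eta (slope A b) W psi.
Proof.
move=> b0 eta0 dA cA' A_ge A_sub; split.
  have [gmax gmax0 gle] := slope_bounded b0 eta0 dA A_ge.
  have [k k0 gk] := slope_lipschitz b0 eta0 dA cA' A_ge.
  exists (Num.sqrt (2 * eta)), gmax, k; split => //.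
    by rewrite sqrtr_gt0 mulr_gt0.
  by move=> s; exact: slope_ge.
have [W [psi [W0 WK psiK dW dpsi]]] := slope_profile b0 eta0 dA cA' A_ge.
exists W, psi; split; first by split.
by move=> sg c x sg2 Wb; exact: (profile_barrier b0 eta0 dA A_ge A_sub dW sg2 Wb).
Qed.

(** The kinetic energy at height [s] when the total energy is slightly above [F b].
    The surplus grows with the height, for the sake of strictness, and keeps the
    kinetic energy positive up to the height [b], where the cap takes over. *)
Definition rising_energy f (b eta C s : R) : R :=
  primitive f b - primitive f s + eta * (C - (b - s)).

Definition strict_bump f (b eta kappa rho : R) W : Prop :=
  forall xi x : R, barrier_at f eta (fun y => bump W b kappa rho (y - xi)) x.

Section RisingProfile.
Variables (f : R -> R) (a b m C : R).
Hypothesis bi : bistable f a.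

Lemma is_derive_rising_energy (eta s : R) :
  is_derive s 1 (rising_energy f b eta C) (- f s + eta).
Proof.
by have := is_derive_energy bi s => ?; derive_by_rules.
Qed.

Lemma rising_energy_continuous (eta : R) : continuous (fun s => - f s + eta).
Proof.
move=> s; apply: cvgD; last exact: cvg_cst.
by apply: cvgN; exact: (bistable_continuous bi).
Qed.

Lemma rising_energy_ge (eta s : R) : a < b -> b < 1 -> 0 < primitive f b -> 0 < eta ->
  2 <= C -> 0 <= s <= b -> eta <= rising_energy f b eta C s.
Proof.
move=> ab b1 Fb0 eta0 C2 /andP[s0 sb].
have Fs : primitive f s <= primitive f b.
  have [sa|as_] := leP s a; last by apply: (energy_ndecr bi); lra.
  by have := energy_le0 bi s0 sa; lra.
rewrite /rising_energy.
have : eta * 1 <= eta * (C - (b - s)) by rewrite ler_wpM2l; lra.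
by lra.
Qed.

(** A small [eta] makes the orbit nearly horizontal at the height [b], so that a
    cap that is twice as steep there is still low. *)
Lemma rising_profile : a < b -> b < m -> m < 1 -> 0 < primitive f b -> 2 <= C ->
  exists2 eta0, 0 < eta0 & forall eta, 0 < eta -> eta <= eta0 ->
    (exists gmin gmax k, tame_slope (slope (rising_energy f b eta C) b) gmin gmax k) /\
    exists W psi kappa rho, [/\
      profile f b eta (slope (rising_energy f b eta C) b) W psi, 0 < kappa, 0 < rho,
      bump_top b kappa rho <= m & strict_bump f b eta kappa rho W].
Proof.
move=> ab bm m1 Fb0 C2; have [a0 a1 fn fp] := bistable_nodes bi.
have cf : {within `[b, m], continuous f}.
  by apply: continuous_subspaceT; exact: (bistable_continuous bi).
have [c + Hc] := EVT_min (ltW bm) cf.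
rewrite in_itv /= => /andP[bc cm].
pose kappa := f c / 2.
have kappa0 : 0 < kappa by rewrite divr_gt0 // fp; lra.
pose eta0 := Num.min kappa (kappa * (m - b) / (4 * C)).
have e2 : 0 < kappa * (m - b) / (4 * C).
  have mb : 0 < m - b by lra.
  have C0 : 0 < C by lra.
  by rewrite divr_gt0 // mulr_gt0.
exists eta0; first by rewrite lt_min kappa0.
move=> eta eta_gt0 eta_le.
pose g := slope (rising_energy f b eta C) b.
have eta_k : eta <= kappa by apply: le_trans eta_le _; rewrite ge_min lexx.
have eta_m : eta <= kappa * (m - b) / (4 * C).
  by apply: le_trans eta_le _; rewrite ge_min lexx orbT.
have b0 : 0 < b by lra.
have A_ge (s : R) : 0 <= s <= b -> eta <= rising_energy f b eta C s.
  by apply: rising_energy_ge => //; lra.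
have A_sub (s : R) : 0 <= s <= b -> eta <= (- f s + eta) + f s by move=> _; lra.
have [tame [W [psi prof]]] := energy_profile b0 eta_gt0
  (is_derive_rising_energy eta) (@rising_energy_continuous eta) A_ge A_sub.
split => //.
have gb : g b = Num.sqrt (2 * (eta * C)).
  by rewrite /g /slope clamp_id ?(ltW b0) // /rising_energy; congr Num.sqrt; ring.
have C0 : 0 < C by lra.
have eC : 0 < 2 * (eta * C) by rewrite !mulr_gt0.
pose rho := 2 * g b / kappa.
have gb0 : 0 < g b by rewrite gb sqrtr_gt0.
have rho0 : 0 < rho by rewrite divr_gt0 // mulr_gt0.
have top : bump_top b kappa rho <= m.
  have -> : bump_top b kappa rho = b + 2 * g b ^+ 2 / kappa.
    by rewrite /bump_top /rho; field; rewrite gt_eqF.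
  rewrite gb sqr_sqrtr ?(ltW eC) //.
  have -> : 2 * (2 * (eta * C)) / kappa = eta * (4 * C) / kappa by ring.
  suff : eta * (4 * C) / kappa <= m - b by lra.
  move: eta_m; rewrite ler_pdivlMr ?mulr_gt0 // => eta_m.
  by rewrite ler_pdivrMr // (mulrC (m - b)).
exists W, psi, kappa, rho; split => //.
move=> xi x; have [[W0 _ _ dW _] barW] := prof.
have [gmin [gmax [k [gmin0 k0 gge gle _]]]] := tame.
apply: (@bump_barrier _ f W g b eta kappa rho rho0 kappa0 W0 dW) => //.
- by move=> s; exact: lt_le_trans (gge s).
- move=> s /andP[bs st]; have : f c <= f s by apply: Hc; rewrite in_itv /= bs (le_trans st).
  by rewrite /kappa in eta_k *; lra.
- rewrite /rho mulrC divfK ?gt_eqF //; lra.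
Qed.

End RisingProfile.

Section DescendingProfile.
Variables (f : R -> R) (a b n : R).
Hypothesis bi : bistable f a.
Let F := primitive f.

(** Up to the terms in [eta], this is [n ^- 2] times the kinetic energy of the rising
    profile above the height [a], and a constant minus [F] below it.  So [n] of
    these never outweigh the rising profile, and the sum with [F] is
    nondecreasing in the height, as a subsolution requires. *)
Definition descending_energy (eta s : R) : R :=
  (F b + (n ^+ 2 - 1) * (F a + primitive (positive_part f) s)) / n ^+ 2 - F s +
  eta * (2 - (b - s)).

Definition descending_energy' (eta s : R) : R :=
  (n ^+ 2 - 1) / n ^+ 2 * positive_part f s - f s + eta.

Lemma is_derive_descending_energy (eta s : R) :
  is_derive s 1 (descending_energy eta) (descending_energy' eta s).
Proof.
have := is_derive_energy bi s => ?; have := is_derive_positive_energy bi s => ?.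
rewrite /descending_energy /descending_energy'.
by derive_by_rules.
Qed.

Lemma descending_energy'_continuous (eta : R) : continuous (descending_energy' eta).
Proof.
move=> s; apply: cvgD; last exact: cvg_cst.
apply: cvgB; last exact: (bistable_continuous bi).
by apply: cvgM; [exact: cvg_cst|exact: (positive_part_continuous bi)].
Qed.

Hypothesis n1 : 1 <= n.
Hypothesis ab : a < b.
Hypothesis b1 : b < 1.
Hypothesis Fb0 : 0 < F b + (n ^+ 2 - 1) * F a.

(** [Fb0] makes the descending energy positive below [a], where [F] is nonpositive;
    above [a] it is positive since [F s <= F b].  The second part uses that [F] is
    nonincreasing on [0 <= s <= a]. *)
Lemma descending_vs_rising (eta s : R) : 0 < eta -> 0 <= s <= b ->
  eta <= descending_energy eta s /\
  n ^+ 2 * descending_energy eta s + eta * n ^+ 2 <=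
    rising_energy f b eta (3 * n ^+ 2) s.
Proof.
have [[[n1' ab'] b1'] Fb0'] := (n1, ab, b1, Fb0).
have [a0 a1 _ _] := bistable_nodes bi.
move=> eta0 /andP[s0 sb].
have M1 : 1 <= n ^+ 2 by rewrite expr_ge1 //; lra.
set M := n ^+ 2 in Fb0' M1 *.
have s1 : s <= 1 by lra.
have E : M * descending_energy eta s =
    F b + (M - 1) * (F a + primitive (positive_part f) s) - M * F s + eta * (M * (2 - (b - s))).
  by rewrite /descending_energy -/M; field; rewrite gt_eqF //; lra.
have pE := positive_energyE bi s0 s1; rewrite -/F in pE.
have Fa0 : F a <= 0 by apply: (energy_le0 bi); lra.
have key : 0 <= F b + (M - 1) * (F a + primitive (positive_part f) s) - M * F s.
  rewrite pE; case: ifPn => [sa|]; last rewrite -ltNge => as_.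
    have Fs : F s <= 0 by apply: (energy_le0 bi).
    have : M * F s <= 0 by rewrite mulr_ge0_le0 //; lra.
    by lra.
  have : F s <= F b by apply: (energy_ndecr bi); lra.
  by lra.
split.
  have Mpos : 0 < M by lra.
  rewrite -(ler_pM2l Mpos) E.
  have : eta * (M * 1) <= eta * (M * (2 - (b - s))).
    by rewrite ler_wpM2l ?(ltW eta0) // ler_wpM2l //; lra.
  by rewrite mulr1 (mulrC eta); lra.
rewrite E /rising_energy -/M -/F.
have key2 : (M - 1) * (F a + primitive (positive_part f) s) <= (M - 1) * F s.
  rewrite ler_wpM2l; [by []|lra|].
  rewrite pE; case: ifPn => [sa|]; last by lra.
  by rewrite addr0; apply: (energy_nincr bi).
have : 0 <= eta * ((M - 1) * (b - s)) by rewrite !mulr_ge0 //; lra.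
have -> : eta * ((M - 1) * (b - s)) = eta * (M * (b - s)) - eta * (b - s) by ring.
have : M * F s = (M - 1) * F s + F s by ring.
have -> : eta * (M * (2 - (b - s))) = 2 * (eta * M) - eta * (M * (b - s)) by ring.
have -> : eta * (3 * M - (b - s)) = 3 * (eta * M) - eta * (b - s) by ring.
by have := mulr_gt0 eta0 (lt_le_trans ltr01 M1); lra.
Qed.

Lemma descending_profile (eta : R) : 0 < eta ->
  let g := slope (descending_energy eta) b in
  (exists gmin gmax k, tame_slope g gmin gmax k) /\
  exists W psi, profile f b eta g W psi.
Proof.
move=> eta0 g.
have [[n1' ab'] b1'] := (n1, ab, b1).
have [a0 a1 _ _] := bistable_nodes bi.
have b0 : 0 < b by lra.
apply: (energy_profile b0 eta0 (is_derive_descending_energy eta)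
  (@descending_energy'_continuous eta)).
  by move=> s sb; have [] := descending_vs_rising eta0 sb.
move=> s _; rewrite /descending_energy'.
have M1 : 1 <= n ^+ 2 by rewrite expr_ge1 //; lra.
have : 0 <= (n ^+ 2 - 1) / n ^+ 2 * positive_part f s.
  by rewrite mulr_ge0 // ?divr_ge0 ?sqr_ge0 ?subr_ge0 // /positive_part le_max lexx orbT.
by lra.
Qed.

(** The squares of the two sides differ by a positive constant at least; as slopes
    are bounded, so do the sides themselves.  At a vertex, this is Kirchhoff's balance between one
    rising and [n] descending profiles. *)
Lemma slope_gap (eta : R) : 0 < eta -> exists2 mu, 0 < mu & forall s,
  n * slope (descending_energy eta) b s + mu <=
    slope (rising_energy f b eta (3 * n ^+ 2)) b s.
Proof.
move=> eta0; have [[[n1' ab'] b1'] Fb0'] := (n1, ab, b1, Fb0).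
have [a0 a1 _ _] := bistable_nodes bi.
have b0 : 0 < b by lra.
have M1 : 1 <= n ^+ 2 by rewrite expr_ge1 //; lra.
have A2ge (s : R) : 0 <= s <= b -> eta <= descending_energy eta s.
  by move=> sb; have [] := descending_vs_rising eta0 sb.
have A1ge (s : R) : 0 <= s <= b -> eta <= rising_energy f b eta (3 * n ^+ 2) s.
  move=> sb; have [H1 H2] := descending_vs_rising eta0 sb.
  apply: le_trans H2.
  have : 0 <= n ^+ 2 * descending_energy eta s by rewrite mulr_ge0 ?sqr_ge0 //; lra.
  have : eta * 1 <= eta * n ^+ 2 by rewrite ler_wpM2l // ltW.
  by lra.
have [G G0 gG] := slope_bounded b0 eta0
  (is_derive_rising_energy b (3 * n ^+ 2) bi eta) A1ge.
exists (eta / G) => [|s]; first by rewrite divr_gt0.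
set g2 := slope (descending_energy eta) b s; set g1 := slope _ b s.
have g2_0 : 0 < g2 := slope_gt0 b0 eta0 A2ge s.
have g1_0 : 0 < g1 := slope_gt0 b0 eta0 A1ge s.
have sq : (n * g2) ^+ 2 + 2 * eta <= g1 ^+ 2.
  rewrite exprMn /g2 /g1 (slope_sqr b0 eta0 A2ge) (slope_sqr b0 eta0 A1ge).
  have [_ H] := descending_vs_rising eta0 (clamp_itv s (ltW b0)).
  have : eta * 1 <= eta * n ^+ 2 by rewrite ler_wpM2l // ltW.
  by lra.
have ng2 : 0 < n * g2 by rewrite mulr_gt0 //; lra.
have le12 : n * g2 <= g1.
  by rewrite -(ler_pXn2r (n := 2)) ?nnegrE ?ltW //; lra.
have g1G : g1 <= G by exact: gG.
rewrite -lerBrDl ler_pdivrMr //.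
have : (g1 - n * g2) * (g1 + n * g2) <= (g1 - n * g2) * (2 * G).
  by rewrite ler_wpM2l ?subr_ge0 //; lra.
by rewrite -subr_sqr; lra.
Qed.

End DescendingProfile.

End Energies.

(** * Sweeping a half line *)

Section Sweep.
Context {R : realType}.

(** The parameter that drives the moving barriers.  It stops at [hi], so that the
    final barrier stays below the solution for ever. *)
Definition ramp (lo hi eps T t : R) : R := Num.min (lo + eps * (t - T)) hi.

Lemma ramp_start (lo hi eps T : R) : lo <= hi -> ramp lo hi eps T T = lo.
Proof. by move=> lohi; rewrite /ramp subrr mulr0 addr0 min_l. Qed.

Lemma ramp_le (lo hi eps T t : R) : ramp lo hi eps T t <= hi.
Proof. by rewrite /ramp ge_min lexx orbT. Qed.

Lemma ramp_ge (lo hi eps T t : R) : lo <= hi -> 0 <= eps -> T <= t ->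
  lo <= ramp lo hi eps T t.
Proof.
move=> lohi eps0 Tt; rewrite /ramp le_min lohi andbT lerDl.
by rewrite mulr_ge0 // subr_ge0.
Qed.

Lemma ramp_end (lo hi eps T t : R) : 0 < eps -> T + (hi - lo) / eps <= t ->
  ramp lo hi eps T t = hi.
Proof.
move=> eps0 Tt; rewrite /ramp min_r //.
have : (hi - lo) / eps <= t - T by lra.
by rewrite ler_pdivrMr // mulrC; lra.
Qed.

Lemma ramp_lipschitz (lo hi eps T s t : R) : 0 <= eps ->
  `|ramp lo hi eps T t - ramp lo hi eps T s| <= eps * `|t - s|.
Proof.
move=> eps0; apply: le_trans (dist_min_le _ _ _) _.
have -> : lo + eps * (t - T) - (lo + eps * (s - T)) = eps * (t - s) by ring.
by rewrite normrM ger0_norm.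
Qed.

Lemma ramp_continuous (lo hi eps T : R) : 0 <= eps -> continuous (ramp lo hi eps T).
Proof.
move=> eps0; apply: (@lipschitz_continuous _ _ eps) => s t; exact: ramp_lipschitz.
Qed.

Lemma continuous_translation (B c : R -> R) : continuous B -> continuous c ->
  continuous (fun tx : R * R => B (tx.2 + c tx.1)).
Proof.
move=> cB cc tx.
apply: (@cvg_comp _ _ _ (fun tx : R * R => tx.2 + c tx.1) B _ _ _ _ (cB _)).
apply: cvgD; first exact: cvg_snd.
by apply: (@cvg_comp _ _ _ fst c _ _ _ _ (cc _)); exact: cvg_fst.
Qed.

Lemma continuous_separated (c q h : R -> R) : continuous c -> continuous q ->
  continuous h -> continuous (fun tx : R * R => c tx.1 + q tx.1 * h tx.2).
Proof.
move=> cc cq ch tx; apply: cvgD; first by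
  apply: (@cvg_comp _ _ _ fst c _ _ _ _ (cc _)); exact: cvg_fst.
apply: cvgM.
  by apply: (@cvg_comp _ _ _ fst q _ _ _ _ (cq _)); exact: cvg_fst.
by apply: (@cvg_comp _ _ _ snd h _ _ _ _ (ch _)); exact: cvg_snd.
Qed.

Lemma edge_point_points (G : metric_graph R) (e : edge G) (x : R) :
  edge_dom e x -> points G (edge_point e x).
Proof.
move=> [x0 xl]; rewrite /edge_point; case: ifPn => // xn0; case: ifPn => //= xnl.
by split; rewrite lt_neqAle ?(eq_sym 0) ?xn0 ?xnl.
Qed.

(** A bump hidden behind the vertex of a half line is moved out along it.  It
    cannot meet [u] at the vertex, where [u] exceeds its height. *)
Lemma bump_sweep (G : metric_graph R) (f : R -> R) (u : R -> graph_point G -> R)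
    (e : edge G) (B : R -> R) (eta K Y top T X : R) :
  entire_solution f u -> (forall t p, points G p -> 0 < u t p < 1) ->
  len e = +oo%E -> 0 < eta -> 0 < K -> 0 <= Y ->
  (forall x y, `|B x - B y| <= K * `|x - y|) ->
  (forall xi x, barrier_at f eta (fun y => B (y - xi)) x) ->
  (forall y, B y <= top) -> (forall y, Y <= `|y| -> B y <= 0) ->
  (forall t, T <= t -> top < u t (Vertex (src e))) ->
  exists T', forall t x, T' <= t -> 0 <= x -> x <= X -> B 0 < u t (edge_point e x).
Proof.
move=> sol u01 le eta0 K0 Y0 BK Bbar Btop B0 uv.
have [ucont _ _ _] := sol.
have upos e' x t : edge_dom e' x -> 0 < u t (edge_point e' x).
  by move=> /edge_point_points/(u01 t)/andP[].
have dome x : 0 <= x -> edge_dom e x by move=> x0; split; rewrite ?le ?leey.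
(* At speed [eps] the values of the moving bump change at rate [eta / 2] at most. *)
pose eps := eta / (2 * K).
have eps0 : 0 < eps by rewrite divr_gt0 // mulr_gt0.
have reach x : 0 <= x -> forall t, T + (x + Y) / eps <= t -> B 0 < u t (edge_point e x).
  move=> x0 t Tt.
  have xY : - Y <= x by lra.
  have Tt' : T <= t.
    by apply: le_trans Tt; rewrite lerDl divr_ge0 ?(ltW eps0) //; lra.
  pose xi := ramp (- Y) x eps T.
  (* A positive function never meets the value [-1], so contacts are on [e]. *)
  pose z e' (s y : R) : R := if e' == e then B (y + - xi s) else -1.
  suff H : z e t x < u t (edge_point e x).
    move: H; rewrite /z eqxx /xi ramp_end ?subrr // opprK.
    exact: Tt.
  have cB : continuous B := lipschitz_continuous BK.
  have cxi : continuous xi := @ramp_continuous _ _ _ _ (ltW eps0).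
  apply: (comparison ucont _ _ _ _ Tt' (dome x x0)).
  - move=> e'; rewrite /z; case: (e' == e); last by move=> ?; exact: cvg_cst.
    apply: (@continuous_translation B (fun s => - xi s) cB).
    by move=> s; apply: cvgN; exact: cxi.
  - move=> e' t1; exists (x + Y) => s y _ _ ye yx; rewrite /z; case: eqP => [ee|_].
      apply: le_lt_trans (upos e' y s ye); apply: B0.
      have := ramp_le (- Y) x eps T s; rewrite -/(xi s) => xix.
      by rewrite ger0_norm; lra.
    by apply: lt_trans (upos e' y s ye); rewrite ltrN10.
  - move=> e' y ye; rewrite /z /xi ramp_start // opprK; case: eqP => [ee|_].
      apply: le_lt_trans (upos e' y T ye); apply: B0.
      have [y0 _] := ye.
      by rewrite ger0_norm; lra.
    by apply: lt_trans (upos e' y T ye); rewrite ltrN10.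
  - move=> e' s y Ts ye above before; rewrite /z; case: eqP => [ee|_]; last first.
      by move=> E; have := upos e' y s ye; rewrite E ltNge => /negP; apply; lra.
    subst e'; move=> eq.
    have [y0|y0] := eqVneq y 0.
      move: eq; rewrite y0 /edge_point eqxx => eq.
      by have := uv s (ltW Ts); rewrite eq ltNge Btop.
    have [yge _] := ye.
    apply: (@no_interior_contact _ G f u (fun s y => B (y + - xi s)) e eta (eta / 2) T s y sol u01) => //.
    + lra.
    + move=> r rs.
      have := BK (y + - xi s) (y + - xi r).
      have -> : y + - xi s - (y + - xi r) = - (xi s - xi r) by ring.
      rewrite normrN => BB.
      have := @ramp_lipschitz (- Y) x eps T r s (ltW eps0); rewrite -/(xi s) -/(xi r).
      move=> /(ler_wpM2l (ltW K0)).
      have -> : K * (eps * `|s - r|) = eta / 2 * (s - r).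
        by rewrite gtr0_norm ?subr_gt0 // /eps; field; rewrite gt_eqF.
      move: BB => /(le_trans (ler_norm _)); lra.
    + by rewrite lt_neqAle eq_sym y0.
    + by rewrite le ltry.
    + by move=> y' y'e; have := above e y' y'e; rewrite /z eqxx.
    + by move=> r Tr rs; have := before r Tr rs; rewrite /z eqxx.
exists (T + (X + Y) / eps) => t x Tt x0 xX; apply: reach => //.
apply: le_trans Tt; rewrite lerD2l ler_wpM2r ?invr_ge0 ?(ltW eps0) //.
by lra.
Qed.

End Sweep.

(** * Barriers on the attached graph *)

Section Attached.
Context {R : realType} (D : metric_graph R) (N : nat) (P : 'I_N -> vertex D).
Hypothesis bounded_D : bounded_graph D.
Local Notation G := (attach P).
Implicit Types (f : R -> R) (h : vertex D -> R) (u : R -> graph_point G -> R).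

(** The solution of [w'' = k] on the edge [e] with the boundary values of [h]. *)
Definition potential (h : vertex D -> R) (k : R) (e : edge D) (x : R) : R :=
  h (src e) + (h (tgt e) - h (src e)) * (x / fine (len e)) +
  k / 2 * (x * (x - fine (len e))).

(** On [D], a potential that is fixed except for its height [theta] and its
    strength [S], both functions of time. *)
Definition attached_barrier (theta S : R -> R) (h : vertex D -> R) (k : R)
    (Z : 'I_N -> R -> R -> R) (e : edge G) (t x : R) : R :=
  match e with
  | inl e => theta t + S t * potential h k e x
  | inr j => Z j t x
  end.

Lemma potential_src h k e : potential h k e 0 = h (src e).
Proof. by rewrite /potential !mul0r !mulr0 !addr0. Qed.

Lemma potential_tgt h k e : potential h k e (fine (len e)) = h (tgt e).
Proof.
by rewrite /potential subrr !mulr0 divff ?(edge_length_neq0 bounded_D) //; ring.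
Qed.

Lemma is_derive_potential h k e (x : R) : is_derive x 1 (potential h k e)
  ((h (tgt e) - h (src e)) / fine (len e) + k / 2 * (2 * x - fine (len e))).
Proof.
rewrite /potential.
by derive_by_rules.
Qed.

Lemma potential_derive_derive h k e (x : R) :
  is_derive x 1 (fun x => (h (tgt e) - h (src e)) / fine (len e) +
    k / 2 * (2 * x - fine (len e))) k.
Proof. by derive_by_rules; field. Qed.

Lemma edge_length_le_total (e : edge D) : fine (len e) <= \sum_(e : edge D) fine (len e).
Proof.
rewrite (bigD1 e) //= lerDl sumr_ge0 // => e' _.
by rewrite ltW // (edge_length_gt0 bounded_D).
Qed.

Lemma potential_bound h k (C : R) e (x : R) : (forall v, `|h v| <= C) -> edge_dom e x ->
  `|potential h k e x| <= C + `|k| * (\sum_(e : edge D) fine (len e)) ^+ 2.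
Proof.
move=> hC [x0 xl].
have L0 := edge_length_gt0 bounded_D e; have LD := edge_length_le_total e.
set L := fine (len e) in L0 LD *; set LL := \sum_e _ in LD *.
have xL : x <= L by rewrite -lee_fin fineK // bounded_D.
have [r [rE r0 r1]] : exists r : R, [/\ x / L = r, 0 <= r & r <= 1].
  by exists (x / L); rewrite divr_ge0 ?(ltW L0) // ler_pdivrMr // mul1r.
have -> : potential h k e x = ((1 - r) * h (src e) + r * h (tgt e)) + k / 2 * (x * (x - L)).
  by rewrite /potential -/L rE; ring.
apply: le_trans (ler_normD _ _) _; apply: lerD.
  apply: le_trans (ler_normD _ _) _; rewrite !normrM (ger0_norm r0).
  have r2 : 0 <= 1 - r by rewrite subr_ge0.
  rewrite (ger0_norm r2).
  have -> : C = (1 - r) * C + r * C by ring.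
  by rewrite lerD // ler_wpM2l // subr_ge0.
rewrite normrM normrM -mulrA ler_wpM2l //.
have -> : `|2^-1| = 2^-1 :> R by rewrite ger0_norm // invr_ge0.
have xLL : `|x * (x - L)| <= LL ^+ 2.
  rewrite normrM expr2 (ger0_norm x0) distrC ger0_norm ?subr_ge0 //.
  by rewrite ler_pM // ?subr_ge0 //; lra.
have := normr_ge0 (x * (x - L)); lra.
Qed.

Lemma attached_src_sum (p : edge G -> R) (v : vertex D) :
  \sum_(e : edge G | src e == v) p e =
  \sum_(e : edge D | src e == v) p (inl e) + \sum_(j | P j == v) p (inr j).
Proof. exact: big_sumType. Qed.

Lemma attached_tgt_sum (q : edge G -> R) (v : vertex D) :
  \sum_(e : edge G | (len e != +oo%E) && (tgt e == v)) q e =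
  \sum_(e : edge D | tgt e == v) q (inl e).
Proof.
rewrite big_sumType /= [X in _ + X]big1 ?addr0.
  by apply: eq_bigl => e; have /fin_numP[_ ->] := bounded_D e.
by [].
Qed.

(** A first contact is impossible inside an edge, where the barrier is a strict
    subsolution, and at a vertex, where its slopes contradict Kirchhoff's condition.
    Being a subsolution is required at contacts only, since there the value of the
    barrier inherits the bounds on [u]. *)
Lemma attached_comparison f u (T eta k0 : R) (theta S : R -> R) (h : vertex D -> R)
    (k : R) (b : vertex D -> R) (Z : 'I_N -> R -> R -> R) (slope0 : 'I_N -> R -> R) :
  entire_solution f u -> (forall t p, points G p -> 0 < u t p < 1) ->
  (forall v, \sum_(e : edge D | src e == v)
        ((h (tgt e) - h (src e)) / fine (len e) - k / 2 * fine (len e)) +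
      \sum_(e : edge D | tgt e == v)
        - ((h (tgt e) - h (src e)) / fine (len e) + k / 2 * fine (len e)) = b v) ->
  continuous theta -> continuous S ->
  (forall j, continuous (fun tx : R * R => Z j tx.1 tx.2)) ->
  (forall j t1, exists X, forall t x, T <= t -> t <= t1 -> X < x -> Z j t x <= 0) ->
  let z := attached_barrier theta S h k Z in
  (forall e x, edge_dom e x -> z e T x < u T (edge_point e x)) ->
  (forall j t, Z j t 0 = theta t + S t * h (P j)) ->
  (forall j t, T < t -> is_derive (0 : R) 1 (Z j t) (slope0 j t)) ->
  (forall v t, T < t -> 0 < S t * b v + \sum_(j | P j == v) slope0 j t) ->
  k0 < eta -> (forall e x s t, edge_dom e x -> s < t -> z e t x - k0 * (t - s) <= z e s x) ->
  (forall (e : edge D) t x, T < t -> edge_dom e x ->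
     u t (edge_point (inl e : edge G) x) = theta t + S t * potential h k e x ->
     eta <= S t * k + f (theta t + S t * potential h k e x)) ->
  (forall j t x, T < t -> 0 < x -> u t (edge_point (inr j : edge G) x) = Z j t x ->
     barrier_at f eta (Z j t) x) ->
  forall t e x, T <= t -> edge_dom e x -> z e t x < u t (edge_point e x).
Proof.
move=> sol u01 flux ctheta cS cZ far z init vertexZ dZ pos keta speed subD subZ.
have [ucont _ uder ukir] := sol.
have upos e x t : edge_dom e x -> 0 < u t (edge_point e x).
  by move=> /edge_point_points/(u01 t)/andP[].
have vertex_touch v t : T < t ->
    (forall e x, edge_dom e x -> z e t x <= u t (edge_point e x)) ->
    u t (Vertex v) = theta t + S t * h v -> False.
  move=> Tt above eq.
  pose sl (e : edge G) (x : R) : R := match e with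
    | inl e => S t * ((h (tgt e) - h (src e)) / fine (len e) + k / 2 * (2 * x - fine (len e)))
    | inr j => slope0 j t end.
  apply: (@no_vertex_contact _ G (u t) (fun e => z e t) (fun e => sl e 0)
    (fun e => sl e (fine (len e))) v (ukir t)) => //.
  - by move=> e x xe; have [H _] := uder e t; exact: H.
  - case=> [e|j] _; rewrite /z /sl /=; last exact: dZ.
    by have := is_derive_potential h k e 0 => ?; derive_by_rules.
  - case=> [e|j] //= _ _.
    by have := is_derive_potential h k e (fine (len e)) => ?; rewrite /z /sl /=; derive_by_rules.
  - case=> [e|j] /= ev; rewrite eq -ev /z /=.
      by rewrite potential_src.
    by rewrite vertexZ.
  - by case=> [e|j] //= _ ev; rewrite eq -ev /z /= potential_tgt.
  rewrite attached_src_sum attached_tgt_sum /= addrAC.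
  apply: lt_le_trans (pos v t Tt) _; rewrite lerD2r -(flux v) mulrDr !mulr_sumr.
  rewrite le_eqVlt; apply/orP; left; apply/eqP; congr (_ + _); apply: eq_bigr => e _;
    by rewrite /sl /=; field; exact: edge_length_neq0.
apply: (comparison ucont) => //.
- case=> [e|j]; rewrite /z /=; last exact: cZ.
  apply: (continuous_separated ctheta cS).
  by apply: is_derive_continuous; exact: is_derive_potential.
- case=> [e|j] t1.
    exists (fine (len e)) => t x _ _ [_ xe]; rewrite ltNge -lee_fin fineK ?bounded_D //.
    by rewrite xe.
  have [X HX] := far j t1; exists X => t x Tt tt1 xe Xx.
  exact: le_lt_trans (HX t x Tt tt1 Xx) (upos (inr j) x t xe).
move=> e t x Tt xe above before eq.
have contact0 : x = 0 -> False.
  move=> x0; apply: (@vertex_touch (src e) t Tt above).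
  move: eq; rewrite x0 /edge_point eqxx => ->; rewrite /z.
  by case: (e) => [e'|j] /=; rewrite ?potential_src ?vertexZ.
have contactL : len e != +oo%E -> x = fine (len e) -> False.
  move=> lfin xL; apply: (@vertex_touch (tgt e) t Tt above).
  move: eq; rewrite xL edge_point_end // => ->; rewrite /z.
  by case: (e) lfin => [e'|j] //= _; rewrite potential_tgt.
have [xge xle] := xe.
have xgt : 0 < x by rewrite lt_neqAle xge andbT eq_sym; apply/eqP.
have xlt : (x%:E < len e)%E.
  rewrite lt_neqAle xle andbT; apply/eqP => E.
  by apply: contactL; rewrite -?E.
apply: (@no_interior_contact _ G f u (z e) e eta k0 T t x sol u01) => //.
- case: e xe above before eq {contact0 contactL xle xlt} => [e|j] xe above before eq.
    have eqz : u t (edge_point (inl e : edge G) x) = theta t + S t * potential h k e x by [].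
    pose q (y : R) : R := theta t + S t * potential h k e y.
    have dq (y : R) : is_derive y 1 q (S t *
       ((h (tgt e) - h (src e)) / fine (len e) + k / 2 * (2 * y - fine (len e)))).
      by have := is_derive_potential h k e y => ?; rewrite /q; derive_by_rules.
    apply: (smooth_barrier (q := q) (q'' := S t * k)).
    + by near=> y.
    + by near=> y; exact: dq.
    + by have := potential_derive_derive h k e x => ?; derive_by_rules.
    + by move=> _; exact: subD.
  by apply: subZ.
- by move=> s st; exact: speed.
- by move=> x' x'e; exact: above.
Unshelve. all: end_near. Qed.

(** On a half line the barrier that lifts [u] to [1] leaves the vertex upwards, for
    Kirchhoff's condition; it is nearly flat up to [X], so that the lift is felt
    there, and negative far out, where nothing but [u > 0] is known. *)
Lemma flat_parabola (e X H d : R) : 0 < e -> 0 <= X -> 0 < H -> 0 < d ->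
  exists kappa tau Xfar, [/\ 0 < kappa <= d, 0 < tau <= d,
    forall x, `|x| <= H -> `|tau * x| <= e / 8,
    forall x, tau * x - kappa / 2 * x ^+ 2 <= e / 8 &
    (forall x, Xfar < x -> tau * x - kappa / 2 * x ^+ 2 <= -1) /\
    (forall x, 0 <= x -> x <= X -> - (e / 8) <= tau * x - kappa / 2 * x ^+ 2)].
Proof.
move=> e0 X0 H0 d0; have e40 : 0 < e / 4 by lra.
have [kappa [kappa0 kappa_d kappaX]] : exists kappa : R,
    [/\ 0 < kappa, kappa <= d & kappa * X ^+ 2 <= e / 4].
  have X1 : 0 < X ^+ 2 + 1 by rewrite ltr_wpDl // sqr_ge0.
  have k0 : 0 < Num.min d (e / (4 * (X ^+ 2 + 1))).
    by rewrite lt_min d0 divr_gt0 // mulr_gt0.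
  exists (Num.min d (e / (4 * (X ^+ 2 + 1)))); split=> //.
    by rewrite ge_min lexx.
  apply: (@le_trans _ _ (e / (4 * (X ^+ 2 + 1)) * X ^+ 2)).
    by rewrite ler_wpM2r ?sqr_ge0 // ge_min lexx orbT.
  rewrite mulrAC ler_pdivrMr ?mulr_gt0 //.
  have -> : e / 4 * (4 * (X ^+ 2 + 1)) = e * X ^+ 2 + e by field.
  by rewrite lerDl ltW.
have [tau [tau0 tau_k tau_e tauH]] : exists tau : R, [/\ 0 < tau, tau <= kappa,
    tau <= e / 4 & forall x : R, `|x| <= H -> `|tau * x| <= e / 8].
  have t0 : 0 < e / (8 * H) by rewrite divr_gt0 // mulr_gt0.
  exists (Num.min (Num.min kappa (e / 4)) (e / (8 * H))); split.
  - by rewrite !lt_min kappa0 e40.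
  - by rewrite !ge_min lexx.
  - by rewrite !ge_min lexx orbT.
  - move=> x xH; rewrite normrM gtr0_norm ?lt_min ?kappa0 ?e40 //.
    apply: (@le_trans _ _ (e / (8 * H) * H)); last first.
      by rewrite le_eqVlt; apply/orP; left; apply/eqP; field; rewrite gt_eqF.
    by rewrite ler_pM // ?le_min ?(ltW t0) ?(ltW kappa0) ?(ltW e40) // ge_min lexx orbT.
have k20 : 0 < 2 / kappa by rewrite divr_gt0.
exists kappa, tau, (2 + 2 / kappa); split=> //.
- by rewrite kappa0.
- by rewrite tau0 (le_trans tau_k).
- move=> x.
  have : 0 <= kappa / 2 * (x - tau / kappa) ^+ 2.
    by rewrite mulr_ge0 ?sqr_ge0 // divr_ge0 // ltW.
  have -> : kappa / 2 * (x - tau / kappa) ^+ 2 =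
      tau / kappa * tau / 2 - (tau * x - kappa / 2 * x ^+ 2).
    by field; rewrite gt_eqF.
  have : tau / kappa * tau <= 1 * (e / 4).
    rewrite ler_pM ?(ltW tau0) // ?divr_ge0 ?(ltW tau0) ?(ltW kappa0) //.
    by rewrite ler_pdivrMr // mul1r.
  by lra.
split=> x.
  move=> xf; have x0 : 0 < x by lra.
  have : tau * x <= kappa * x by rewrite ler_wpM2r // ltW.
  have : kappa / 2 * (2 * (2 / kappa)) <= kappa / 2 * (x * (x - 2)).
    rewrite ler_wpM2l ?divr_ge0 ?(ltW kappa0) // ler_pM ?(ltW k20) //; lra.
  have -> : kappa / 2 * (2 * (2 / kappa)) = 2 by field; rewrite gt_eqF.
  have -> : kappa / 2 * (x * (x - 2)) = kappa / 2 * x ^+ 2 - kappa * x by field.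
  by lra.
move=> x0 xX.
have : kappa / 2 * x ^+ 2 <= kappa / 2 * X ^+ 2.
  by rewrite ler_wpM2l ?divr_ge0 ?(ltW kappa0) // ler_pXn2r.
have : 0 <= tau * x by rewrite mulr_ge0 // ltW.
by lra.
Qed.

(** Once [u] exceeds a level above [a] on a large ball, it is lifted to [1] there
    by wide and flat parabolas of increasing height. *)
Lemma fill (f : R -> R) (a l : R) (j0 : 'I_N) u : bistable f a -> a < l -> l < 1 ->
  entire_solution f u -> (forall t p, points G p -> 0 < u t p < 1) ->
  (forall X, exists T, forall t, T <= t ->
     (forall (e : edge D) x, edge_dom e x -> l < u t (edge_point (inl e : edge G) x)) /\
     (forall j x, 0 <= x -> x <= X -> l < u t (edge_point (inr j : edge G) x))) ->
  forall e X : R, 0 < e -> l < 1 - e -> 0 <= X -> exists T, forall t, T <= t ->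
     (forall (d : edge D) x, edge_dom d x -> 1 - e < u t (edge_point (inl d : edge G) x)) /\
     (forall j x, 0 <= x -> x <= X -> 1 - e < u t (edge_point (inr j : edge G) x)).
Proof.
move=> bi al l1 sol u01 above_l e X e0 le X0.
have [a0 a1 fn fp] := bistable_nodes bi.
have upos d x t : edge_dom d x -> 0 < u t (edge_point d x).
  by move=> /edge_point_points/(u01 t)/andP[].
have [fe fe0 Hfe] : exists2 fe, 0 < fe & forall s : R, l <= s -> s <= 1 - e / 4 -> fe <= f s.
  have cf : {within `[l, 1 - e / 4], continuous f}.
    by apply: continuous_subspaceT; exact: (bistable_continuous bi).
  have le4 : l <= 1 - e / 4 by lra.
  have [c + Hc] := EVT_min le4 cf.
  rewrite in_itv /= => /andP[lc c1]; exists (f c); first by apply: fp; lra.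
  by move=> s ls s1; apply: Hc; rewrite in_itv /=; apply/andP.
pose LL := \sum_(d : edge D) fine (len d).
have LL0 : 0 <= LL by rewrite sumr_ge0 // => d _; rewrite ltW // (edge_length_gt0 bounded_D).
pose nv v : R := \sum_(j | P j == v) 1.
have sum_nv : \sum_v nv v = N%:R.
  have -> : N%:R = \sum_(j : 'I_N) (1 : R) by rewrite sumr_const card_ord.
  by rewrite [RHS](partition_big P xpredT).
have card0 : 0 < #|vertex D|%:R :> R by rewrite ltr0n; apply/card_gt0P; exists (P j0).
(* The potential is concave, so its outward fluxes add up to [LL].  Distributed
   evenly, they leave [q] at every vertex once the half lines contribute [nv v]. *)
pose q := (N%:R + LL) / #|vertex D|%:R.
have N0 : 0 < N%:R :> R by rewrite ltr0n; apply: leq_ltn_trans (ltn_ord j0).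
have q0 : 0 < q by rewrite divr_gt0 // ltr_wpDr.
pose b v := q - nv v.
have sumb : \sum_v b v = - (-1 * \sum_(d : edge D) fine (len d)).
  rewrite sumrB sum_nv sumr_const -[q *+ _]mulr_natr /q divfK ?gt_eqF // /LL; ring.
pose BB := \sum_v `|b v| + `|-1| * LL + 1.
have BB0 : 0 < BB.
  by rewrite ltr_wpDl // addr_ge0 // ?sumr_ge0 // mulr_ge0.
have leBB : \sum_v `|b v| + `|-1| * \sum_(d : edge D) fine (len d) <= BB.
  by rewrite /BB /LL lerDl.
have [h [flux hB]] := graph_poisson bounded_D (P j0) BB0 sumb leBB.
pose Hb : R := BB * LL + `|-1| * LL ^+ 2 + 1.
have Hb0 : 0 < Hb.
  by rewrite ltr_wpDl // addr_ge0 // mulr_ge0 ?sqr_ge0 // ltW.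
have potB d x : edge_dom d x -> `|potential h (-1) d x| <= Hb.
  move=> dx; apply: le_trans (potential_bound (-1) hB dx) _.
  by rewrite /Hb /LL; lra.
have hHb v : `|h v| <= Hb.
  apply: le_trans (hB v) _; rewrite /Hb -/LL -addrA lerDl addr_ge0 //.
  by rewrite mulr_ge0 // sqr_ge0.
have eps0 : 0 < fe / 4 by rewrite divr_gt0.
have [kappa [tau [Xfar [/andP[kappa0 kappa_f] /andP[tau0 tau_f] tauH parab_le]]]] :=
  flat_parabola e0 X0 Hb0 eps0.
pose parab (x : R) : R := tau * x - kappa / 2 * x ^+ 2.
move=> [parab_far parab_ge].
have [T HT] := above_l Xfar.
pose theta := ramp (l - e / 4) (1 - e / 2) (fe / 4) T.
have lohi : l - e / 4 <= 1 - e / 2 by clear - le e0; lra.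
have thetaM t : theta t <= 1 - e / 2 := ramp_le _ _ _ _ _.
pose Z (j : 'I_N) (t x : R) : R := theta t + tau * h (P j) + parab x.
pose z := attached_barrier theta (fun=> tau) h (-1) Z.
have ctheta : continuous theta := @ramp_continuous _ _ _ _ _ (ltW eps0).
have dparab (x : R) : is_derive x 1 parab (tau - kappa * x).
  by rewrite /parab; derive_by_rules; field.
have cparab : continuous parab := is_derive_continuous dparab.
have z_le d x t : edge_dom d x -> z d t x <= theta t + e / 4.
  case: d => [d|j] dx; rewrite /z /=.
    by have /tauH/(le_trans (ler_norm _)) := potB d x dx; clear - e0; lra.
  have /tauH/(le_trans (ler_norm _)) := hHb (P j); have := parab_le x.
  by rewrite /Z /parab; clear; lra.
have Zfar j t x : Xfar < x -> Z j t x <= 0.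
  move=> /parab_far px; have /tauH/(le_trans (ler_norm _)) := hHb (P j).
  by have := thetaM t; rewrite /Z /parab; move: px; clear - e0; lra.
have touch_f d x t : T <= t -> edge_dom d x -> u t (edge_point d x) = z d t x ->
    fe <= f (z d t x).
  move=> Tt dx eq; apply: Hfe; last first.
    by have := z_le d x t dx; have := thetaM t; clear; lra.
  rewrite -eq; have [H1 H2] := HT t Tt.
  case: d dx eq => [d|j] dx eq; first by apply: ltW; exact: H1.
  have [xf|xf] := leP x Xfar; first by apply: ltW; apply: H2 => //; case: dx.
  by have := upos (inr j) x t dx; rewrite eq ltNge /z /= Zfar.
have main : forall t d x, T <= t -> edge_dom d x -> z d t x < u t (edge_point d x).
  apply: (@attached_comparison f u T (fe / 2) (fe / 4) theta (fun=> tau) h (-1) b Z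
    (fun _ _ => tau) sol u01 flux ctheta) => //.
  - by move=> ?; exact: cvg_cst.
  - move=> j tx; rewrite /Z; apply: cvgD.
      apply: cvgD; last exact: cvg_cst.
      by apply: (@cvg_comp _ _ _ fst theta _ _ _ _ (ctheta _)); exact: cvg_fst.
    by apply: (@cvg_comp _ _ _ snd parab _ _ _ _ (cparab _)); exact: cvg_snd.
  - by move=> j t1; exists Xfar => t x _ _; exact: Zfar.
  - move=> d x dx; have [H1 H2] := HT T (lexx T).
    have zl : z d T x <= l by have := z_le d x T dx; rewrite /theta ramp_start //; lra.
    case: d dx zl => [d|j] dx zl; first by apply: le_lt_trans zl _; exact: H1.
    have [xf|xf] := leP x Xfar.
      by apply: le_lt_trans zl _; apply: H2 => //; case: dx.
    by apply: le_lt_trans (upos (inr j) x T dx); exact: Zfar.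
  - by move=> j t; rewrite /Z /parab expr0n /= !mulr0 subr0 addr0.
  - move=> j t _; have := dparab 0 => ?; rewrite /Z; derive_by_rules.
  - move=> v t _.
    have -> : \sum_(j | P j == v) tau = tau * nv v by rewrite mulr_sumr; under [RHS]eq_bigr do rewrite mulr1.
    by rewrite -mulrDr subrK mulr_gt0.
  - by lra.
  - move=> d x s t dx st.
    have : `|theta t - theta s| <= fe / 4 * `|t - s|.
      by apply: ramp_lipschitz; exact: ltW.
    rewrite (gtr0_norm (_ : 0 < t - s)) ?subr_gt0 // => /(le_trans (ler_norm _)).
    by case: (d) => [d'|j]; rewrite /attached_barrier /Z; lra.
  - move=> d t x Tt dx eq.
    have := touch_f (inl d) x t (ltW Tt) dx eq; rewrite /z /=; lra.
  - move=> j t x Tt x0 eq.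
    have dx : edge_dom (inr j : edge G) x by split; [exact: ltW|rewrite leey].
    have := touch_f (inr j) x t (ltW Tt) dx eq; rewrite /z /= => fZ.
    apply: (smooth_barrier (q := Z j t) (q' := fun x => tau - kappa * x) (q'' := - kappa)).
    + by near=> y.
    + by near=> y; have := dparab y => ?; rewrite /Z; derive_by_rules.
    + by derive_by_rules.
    + by move=> _; lra.
pose T1 := T + ((1 - e / 2) - (l - e / 4)) / (fe / 4).
exists T1 => t T1t.
have Tt : T <= t.
  apply: le_trans T1t; rewrite /T1 lerDl divr_ge0 ?(ltW eps0) //; lra.
have thetaE : theta t = 1 - e / 2 by apply: ramp_end.
split=> [d x dx|j x x0 xX].
  have := main t (inl d) x Tt dx; rewrite /z /= thetaE.
  by have := tauH _ (potB d x dx); rewrite ler_norml => /andP[+ _]; lra.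
have dx : edge_dom (inr j : edge G) x by split; [|rewrite leey].
have := main t (inr j) x Tt dx; rewrite /z /= /Z thetaE.
have := tauH _ (hHb (P j)); rewrite ler_norml => /andP[+ _].
by have := parab_ge x x0 xX; rewrite /parab; lra.
Unshelve. all: end_near. Qed.

End Attached.

(** * Crossing the center graph *)

Section ProfileFacts.
Context {R : realType}.
Variables (f g W psi : R -> R) (b eta gmin gmax k : R).
Hypothesis prof : profile f b eta g W psi.
Hypothesis tame : tame_slope g gmin gmax k.

Lemma profile_slope_gt0 s : 0 < g s.
Proof. by have [g0 _ gge _ _] := tame; exact: lt_le_trans (gge s). Qed.

Lemma profile_W_lipschitz (x y : R) : `|W x - W y| <= gmax * `|x - y|.
Proof.
have [[_ _ _ dW _] _] := prof; have [_ _ _ gle _] := tame.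
exact: (profile_lipschitz dW profile_slope_gt0 gle).
Qed.

Lemma profile_W_decr (x y : R) : x < y -> W y < W x.
Proof.
have [[_ _ _ dW _] _] := prof; exact: (profile_decr dW profile_slope_gt0).
Qed.

Lemma profile_W_nincr (x y : R) : x <= y -> W y <= W x.
Proof. by rewrite le_eqVlt => /predU1P[->//|/profile_W_decr/ltW]. Qed.

Lemma profile_inv_lipschitz (s t : R) : `|psi s - psi t| <= gmin^-1 * `|s - t|.
Proof.
have [[_ _ _ _ dpsi] _] := prof; have [g0 _ gge _ _] := tame.
apply: (derive_bounded_lipschitz dpsi) => x.
have gx := profile_slope_gt0 x.
by rewrite normrN gtr0_norm ?invr_gt0 // lef_pV2 ?posrE.
Qed.

Lemma profile_inv_le (s t : R) : s <= t -> psi t <= psi s.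
Proof.
move=> st; have [[_ _ psiK _ _] _] := prof.
by rewrite leNgt; apply/negP => /profile_W_decr; rewrite !psiK ltNge st.
Qed.

Lemma profile_inv_lt (s t : R) : s < t -> psi t < psi s.
Proof.
move=> st; have [[_ _ psiK _ _] _] := prof.
by rewrite ltNge; apply/negP => /profile_W_nincr; rewrite !psiK leNgt st.
Qed.

Lemma profile_inv_b : psi b = 0.
Proof. by have [[W0 WK _ _ _] _] := prof; rewrite -W0 WK. Qed.

Lemma profile_W_continuous : continuous W.
Proof. exact: (lipschitz_continuous profile_W_lipschitz). Qed.

Lemma profile_inv_continuous : continuous psi.
Proof. exact: (lipschitz_continuous profile_inv_lipschitz). Qed.

Lemma is_derive_profile_shift (sg c x : R) :
  is_derive x 1 (fun y => W (sg * y + c)) (- g (W (sg * x + c)) * sg).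
Proof.
have [[_ _ _ dW _] _] := prof.
have dl : is_derive x 1 (fun y => sg * y + c) sg by derive_by_rules.
exact: (is_derive1_comp (f := W)).
Qed.

End ProfileFacts.

Section Crossing.
Context {R : realType}.
Variables (f g1 W1 psi1 g2 W2 psi2 : R -> R) (N : nat).
Variables (b m eta kappa rho mu l f0 gmin gmax k0 : R).
Hypothesis N_ge2 : (2 <= N)%N.
Hypothesis l_itv : 0 < l /\ l < b.
Hypothesis eta0 : 0 < eta.
Hypothesis kr0 : 0 < kappa /\ 0 < rho.
Hypothesis mu0 : 0 < mu.
Hypothesis top_le : bump_top b kappa rho <= m.
Hypothesis f0_le : 0 <= f0 /\ forall s, 0 <= s -> s <= 1 -> - f0 <= f s.
Hypothesis prof1 : profile f b eta g1 W1 psi1.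
Hypothesis prof2 : profile f b eta g2 W2 psi2.
Hypothesis tame1 : tame_slope g1 gmin gmax k0.
Hypothesis tame2 : tame_slope g2 gmin gmax k0.
Hypothesis bump1 : strict_bump f b eta kappa rho W1.
Hypothesis gap : forall s, (N%:R - 1) * g2 s + mu <= g1 s.

Lemma bump1_le0 (y : R) : rho + psi1 0 <= `|y| -> bump W1 b kappa rho y <= 0.
Proof.
have [l0 lb] := l_itv; have [_ rho0] := kr0; have [[W10 _ psiK1 dW1 _] _] := prof1.
apply: (bump_le0 kappa rho0 W10 dW1 (profile_slope_gt0 tame1) (Y := psi1 0)).
- by rewrite psiK1.
- by rewrite -[leLHS](profile_inv_b prof1) (profile_inv_le prof1 tame1) //; lra.
Qed.

(** Bounds that keep the effect of [D] small against [mu], in terms of the profiles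
    alone and not of [D]: the second derivative [kD] of the potential outweighs
    [- f] at every strength [gmin] or more; [sigma] is the current that leaks at
    the vertices; a potential below [chi] changes heights by [(b - l) / 4] and
    slopes by [omega] at most; and [B0] bounds the total current, so that a length
    below [delta] keeps the potential below [chi]. *)
Let n : R := N%:R - 1.
Let omega : R := Num.min 1 (mu / (4 * N%:R)).
Let smax : R := gmax + 1.
Let sigma : R := mu / (8 * smax).
Let kD : R := (f0 + eta) / gmin.
Let chi : R := Num.min (omega / (k0 * smax)) ((b - l) / (4 * smax)).
Let B0 : R := 2 * n + 2 * sigma + 2 * kD + 1.
Let delta : R := Num.min 1 (Num.min (sigma / kD) (chi / (B0 + kD))).

Lemma crossing_constants : [/\ 1 <= n, 0 < omega, 0 < smax, 0 < sigma &
  [/\ 0 < kD, 0 < chi, 0 < B0, 0 < delta & omega <= 1 /\ omega * N%:R <= mu / 4]].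
Proof.
have [h1 h2] := l_itv; have h3 := eta0; have [h4 _] := f0_le; have h5 := mu0.
have [gm kk gge gle _] := tame1.
have gx : 0 < gmax by apply: lt_le_trans (gle 0); apply: lt_le_trans (gge 0).
have N2 : 2 <= N%:R :> R by rewrite ler_nat.
have n1 : 1 <= n by rewrite /n; lra.
have o0 : 0 < omega by rewrite lt_min ltr01 divr_gt0 // mulr_gt0 //; lra.
have s0 : 0 < smax by rewrite /smax; lra.
have si0 : 0 < sigma by rewrite divr_gt0 // mulr_gt0.
have kd0 : 0 < kD by rewrite divr_gt0 //; lra.
have c0 : 0 < chi.
  have bl : 0 < b - l by rewrite subr_gt0.
  by rewrite lt_min; apply/andP; split; apply: divr_gt0 => //; apply: mulr_gt0.
have b00 : 0 < B0 by rewrite /B0; lra.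
have bk : 0 < B0 + kD by lra.
split=> //; split=> //.
  by rewrite !lt_min ltr01 /=; apply/andP; split; apply: divr_gt0.
split; first by rewrite ge_min lexx.
have oN : omega <= mu / (4 * N%:R) by rewrite ge_min lexx orbT.
apply: (@le_trans _ _ (mu / (4 * N%:R) * N%:R)); first by rewrite ler_wpM2r.
have N0 : 0 < N%:R :> R by lra.
by rewrite le_eqVlt; apply/orP; left; apply/eqP; field; rewrite gt_eqF.
Qed.

Section Graph.
Variables (D : metric_graph R) (P : 'I_N -> vertex D) (i : 'I_N).
Hypothesis bounded_D : bounded_graph D.
Let LL : R := \sum_(e : edge D) fine (len e).
Hypothesis small_D : LL < delta.
Local Notation G := (attach P).

Lemma small_length : [/\ 0 <= LL, LL <= 1, kD * LL <= sigma & (B0 + kD) * LL <= chi].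
Proof.
have [n1 o0 s0 si0 [kd0 c0 b00 _ _]] := crossing_constants.
have LL0 : 0 <= LL by rewrite sumr_ge0 // => e _; rewrite ltW // edge_length_gt0.
have d1 : delta <= 1 by rewrite ge_min lexx.
have d2 : delta <= sigma / kD by rewrite !ge_min lexx !orbT.
have d3 : delta <= chi / (B0 + kD) by rewrite !ge_min lexx !orbT.
have small := ltW small_D.
have bk : 0 < B0 + kD by rewrite addr_gt0.
split=> //.
- exact: le_trans d1.
- by rewrite mulrC -ler_pdivlMr //; exact: le_trans d2.
- by rewrite mulrC -ler_pdivlMr //; exact: le_trans d3.
Qed.

Let nv (v : vertex D) : R := \sum_(j | (P j == v) && (j != i)) 1.
Let bv (v : vertex D) : R := nv v + sigma / #|vertex D|%:R -
  (if v == P i then n + sigma + kD * LL else 0).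

Lemma nv_ge0 v : 0 <= nv v.
Proof. by rewrite sumr_ge0. Qed.

Lemma sum_nv : \sum_v nv v = n.
Proof.
rewrite /n; have -> : N%:R = \sum_(j : 'I_N) (1 : R) by rewrite sumr_const card_ord.
rewrite (bigD1 i) //= addrAC subrr add0r [RHS](partition_big P xpredT) //=.
by apply: eq_bigr => v _; apply: eq_bigl => j; rewrite andbC.
Qed.

Lemma card_vertex_gt0 : 0 < #|vertex D|%:R :> R.
Proof. by rewrite ltr0n; apply/card_gt0P; exists (P i). Qed.

Lemma sum_mean (x : R) : \sum_(v : vertex D) x / #|vertex D|%:R = x.
Proof.
rewrite sumr_const -[_ *+ _]mulr_natr divfK ?gt_eqF //; exact: card_vertex_gt0.
Qed.

Lemma sum_at (x : R) : \sum_(v : vertex D) (if v == P i then x else 0) = x.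
Proof. by rewrite -big_mkcond big_pred1_eq. Qed.

(** Current flows in at [P i] and out at the other [P j]; a little leaks out at
    every vertex, so that all flux conditions become strict. *)
Lemma crossing_potential : exists h, [/\
  forall v, \sum_(e : edge D | src e == v)
        ((h (tgt e) - h (src e)) / fine (len e) - kD / 2 * fine (len e)) +
      \sum_(e : edge D | tgt e == v)
        - ((h (tgt e) - h (src e)) / fine (len e) + kD / 2 * fine (len e)) = bv v,
  forall v, `|h v| <= chi & forall e x, edge_dom e x -> `|potential h kD e x| <= chi].
Proof.
have [n1 o0 s0 si0 [kd0 c0 b00 _ _]] := crossing_constants.
have [LL0 LL1 kLL BLL] := small_length.
have V0 := card_vertex_gt0.
have sumb : \sum_v bv v = - (kD * \sum_(e : edge D) fine (len e)).
  by rewrite sumrB big_split /= sum_nv sum_mean sum_at -/LL; ring.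
have absb : \sum_v `|bv v| + `|kD| * \sum_(e : edge D) fine (len e) <= B0.
  have : \sum_v `|bv v| <= \sum_v (nv v + sigma / #|vertex D|%:R +
      (if v == P i then n + sigma + kD * LL else 0)).
    apply: ler_sum => v _; rewrite /bv; apply: le_trans (ler_normB _ _) _.
    have ge1 : 0 <= nv v + sigma / #|vertex D|%:R.
      by rewrite addr_ge0 ?nv_ge0 // divr_ge0 // ltW.
    rewrite (ger0_norm ge1) lerD2l ger0_norm //; case: ifP => // _.
    have kl0 : 0 <= kD * LL by rewrite mulr_ge0 // ltW.
    by lra.
  rewrite !big_split /= sum_nv sum_mean sum_at (gtr0_norm kd0) -/LL.
  have : kD * LL <= kD * 1 by rewrite ler_wpM2l // ltW.
  by rewrite /B0; lra.
have [h [flux hB]] := graph_poisson bounded_D (P i) b00 sumb absb.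
have Bchi : B0 * LL + kD * LL <= chi by rewrite -mulrDl.
exists h; split=> // [v|e x xe].
  apply: le_trans (hB v) _; apply: le_trans Bchi; rewrite -/LL lerDl.
  by rewrite mulr_ge0 // ltW.
apply: le_trans (potential_bound bounded_D kD hB xe) _; rewrite -/LL.
apply: le_trans Bchi; rewrite (gtr0_norm kd0) lerD2l ler_wpM2l ?(ltW kd0) //.
by rewrite expr2 ler_piMr.
Qed.

Variable (h : vertex D -> R).
Hypothesis h_flux : forall v, \sum_(e : edge D | src e == v)
        ((h (tgt e) - h (src e)) / fine (len e) - kD / 2 * fine (len e)) +
      \sum_(e : edge D | tgt e == v)
        - ((h (tgt e) - h (src e)) / fine (len e) + kD / 2 * fine (len e)) = bv v.
Hypothesis h_chi : forall v, `|h v| <= chi.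
Hypothesis pot_chi : forall e x, edge_dom e x -> `|potential h kD e x| <= chi.

(** The strength of the potential when the barrier has height [s] on [D]: unit
    currents then carry the slope of one descending profile, with [omega] to spare
    for the dependence of the slope on the height. *)
Let S (s : R) : R := g2 s + omega.
Let height (s : R) (v : vertex D) : R := s + S s * h v.

Lemma S_bounds s : gmin <= S s /\ S s <= smax.
Proof.
have [n1 o0 s0 si0 [kd0 c0 b00 d0 [w1 _]]] := crossing_constants.
by have [_ _ gge gle _] := tame2; rewrite /S /smax; have := gge s; have := gle s; split; lra.
Qed.

Lemma S_gt0 s : 0 < S s.
Proof. by have [] := S_bounds s; have [gm _ _ _ _] := tame2; lra. Qed.

Lemma S_times_chi (s x : R) : `|x| <= chi ->
  `|S s * x| <= (b - l) / 4 /\ k0 * `|S s * x| <= omega.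
Proof.
move=> xc; have [n1 o0 s0 si0 [kd0 c0 b00 d0 [w1 _]]] := crossing_constants.
have [_ Ss] := S_bounds s; have Sp := S_gt0 s; have [gm kk _ _ _] := tame2.
have le : `|S s * x| <= smax * chi.
  by rewrite normrM (gtr0_norm Sp) ler_pM // ltW.
have c1 : chi <= omega / (k0 * smax) by rewrite ge_min lexx.
have c2 : chi <= (b - l) / (4 * smax) by rewrite ge_min lexx orbT.
split.
  apply: le_trans le _; apply: (@le_trans _ _ (smax * ((b - l) / (4 * smax)))).
    by rewrite ler_wpM2l // ltW.
  by rewrite le_eqVlt; apply/orP; left; apply/eqP; field; rewrite gt_eqF.
apply: (@le_trans _ _ (k0 * (smax * chi))); first by rewrite ler_wpM2l // ltW.
apply: (@le_trans _ _ (k0 * (smax * (omega / (k0 * smax))))).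
  by rewrite ler_wpM2l ?(ltW kk) // ler_wpM2l // ltW.
by rewrite le_eqVlt; apply/orP; left; apply/eqP; field; rewrite !gt_eqF.
Qed.

Lemma slope_at_height (g : R -> R) s v : tame_slope g gmin gmax k0 ->
  `|g (height s v) - g s| <= omega.
Proof.
move=> [_ _ _ _ glip]; have [_ H] := S_times_chi s (h_chi v).
apply: le_trans (glip _ _) _; apply: le_trans H.
by rewrite /height addrAC subrr add0r.
Qed.

(** The balance of slopes at the vertices; at [P i] it is the gap between one
    rising and [N - 1] descending profiles that makes it positive. *)
Lemma crossing_flux (s : R) v :
  0 < S s * bv v + \sum_(j | P j == v)
    (if j == i then g1 (height s (P j)) else - g2 (height s (P j))).
Proof.
have [n1 o0 s0 si0 [kd0 c0 b00 d0 [w1 oN]]] := crossing_constants.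
have [LL0 LL1 kLL BLL] := small_length.
have V0 := card_vertex_gt0.
have [_ Ss] := S_bounds s; have Sp := S_gt0 s.
have sumE : \sum_(j | P j == v) (if j == i then g1 (height s (P j)) else - g2 (height s (P j)))
   = (if P i == v then g1 (height s v) else 0) - nv v * g2 (height s v).
  rewrite (bigID (fun j => j == i)) /=; congr (_ + _).
    case: ifPn => Piv.
      rewrite (big_pred1 i) ?eqxx; first by rewrite (eqP Piv).
      by move=> j /=; case: (eqVneq j i) => [->|_]; rewrite ?Piv ?andbF.
    by rewrite big_pred0 // => j; case: (eqVneq j i) => [->|_]; rewrite ?(negbTE Piv) ?andbF.
  rewrite mulr_suml -sumrN; apply: eq_bigr => j /andP[/eqP -> /negbTE ->].
  by rewrite mul1r.
rewrite {}sumE.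
have /ler_normlP[gv2 gv2'] := slope_at_height s v tame2.
have /ler_normlP[gv1 gv1'] := slope_at_height s v tame1.
have SV : 0 < S s * (sigma / #|vertex D|%:R) by rewrite mulr_gt0 // divr_gt0.
have nvS : nv v * g2 (height s v) <= nv v * S s.
  by rewrite ler_wpM2l ?nv_ge0 // /S; lra.
rewrite /bv eq_sym; case: ifPn => Pv.
  have -> : S s * (nv v + sigma / #|vertex D|%:R - (n + sigma + kD * LL)) =
    nv v * S s + S s * (sigma / #|vertex D|%:R) - (S s * n + S s * (sigma + kD * LL)) by ring.
  have : S s * (sigma + kD * LL) <= smax * (2 * sigma).
    have kl0 : 0 <= kD * LL by rewrite mulr_ge0 // ltW.
    by rewrite ler_pM ?(ltW Sp) //; lra.
  have -> : smax * (2 * sigma) = mu / 4 by rewrite /sigma; field; rewrite gt_eqF.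
  have -> : S s * n = n * g2 s + omega * N%:R - omega by rewrite /S /n; ring.
  have := gap s; rewrite -/n; have := mu0; lra.
rewrite subr0 sub0r mulrDr; have : S s * nv v = nv v * S s by rewrite mulrC.
by lra.
Qed.

Lemma height_lipschitz (s t x : R) : `|x| <= chi ->
  `|(s + S s * x) - (t + S t * x)| <= (1 + k0 * chi) * `|s - t|.
Proof.
move=> xc; have [_ kk _ _ glip] := tame2.
have -> : s + S s * x - (t + S t * x) = (s - t) + (g2 s - g2 t) * x by rewrite /S; ring.
apply: le_trans (ler_normD _ _) _; rewrite [leRHS]mulrDl mul1r lerD2l normrM.
by rewrite [leRHS]mulrAC ler_pM.
Qed.

Lemma near_height (s x : R) : `|x| <= chi ->
  s - (b - l) / 4 <= s + S s * x /\ s + S s * x <= s + (b - l) / 4.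
Proof.
by move=> xc; have [/ler_normlP[H1 H2] _] := S_times_chi s xc; split; lra.
Qed.

(** The barrier on the half lines: the bump on the [i]-th one, which meets [P i]
    on its rising side, and descending profiles on the others. *)
Let center (s : R) : R := rho + psi1 (height s (P i)).
Let outer (s : R) (j : 'I_N) (x : R) : R :=
  if j == i then bump W1 b kappa rho (x - center s) else W2 (x + psi2 (height s (P j))).

Lemma outer_vertex s j : s <= (l + b) / 2 -> outer s j 0 = height s (P j).
Proof.
move=> sb; have [[W10 _ psiK1 _ _] _] := prof1; have [[_ _ psiK2 _ _] _] := prof2.
rewrite /outer; case: eqP => [->|_]; last by rewrite add0r psiK2.
have [_ hb] := near_height s (h_chi (P i)); have [_ lb] := l_itv.
have psi0 : 0 <= psi1 (height s (P i)).
  by rewrite -(profile_inv_b prof1) (profile_inv_le prof1 tame1) // /height; lra.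
have [_ rho0] := kr0.
have E : `|0 - center s| = rho + psi1 (height s (P i)).
  by rewrite sub0r normrN /center ger0_norm // addr_ge0 // ltW.
by rewrite (bump_tail kappa W10) E ?lerDl // addrAC subrr add0r psiK1.
Qed.

Lemma is_derive_outer0 s j : s <= (l + b) / 2 -> is_derive (0 : R) 1 (outer s j)
  (if j == i then g1 (height s (P j)) else - g2 (height s (P j))).
Proof.
move=> sb; have [[W10 _ psiK1 _ _] _] := prof1; have [[_ _ psiK2 _ _] _] := prof2.
rewrite /outer; case: eqP => [->|_]; last first.
  have := is_derive_profile_shift prof2 1 (psi2 (height s (P j))) 0.
  rewrite mulr0 add0r psiK2 mulr1 => H.
  by apply: near_eq_is_derive H; near=> y; rewrite mul1r.
have [_ hb] := near_height s (h_chi (P i)); have [_ lb] := l_itv.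
have psi0 : 0 < psi1 (height s (P i)).
  by rewrite -(profile_inv_b prof1) (profile_inv_lt prof1 tame1) // /height; lra.
have [_ rho0] := kr0.
have := is_derive_profile_shift prof1 (-1) (psi1 (height s (P i))) 0.
rewrite mulr0 add0r psiK1 mulrN1 opprK => H.
apply: near_eq_is_derive H; near=> y.
have yp : y <= psi1 (height s (P i)) by apply: ltW; near: y; exact: lt_nbhsl.
have E : `|y - center s| = rho + psi1 (height s (P i)) - y.
  by rewrite distrC ger0_norm /center //; lra.
rewrite (bump_tail kappa W10) E; last by lra.
by congr W1; ring.
Unshelve. all: end_near. Qed.

Lemma outer_barrier s j x : s <= (l + b) / 2 -> 0 < x ->
  barrier_at f eta (outer s j) x.
Proof.
move=> sb x0; rewrite /outer; case: eqP => [_|_]; first exact: bump1.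
have [[_ _ psiK2 _ _] bar] := prof2.
have [_ hb] := near_height s (h_chi (P j)); have [_ lb] := l_itv.
apply: (@near_barrier _ f eta _ (fun y => W2 (1 * y + psi2 (height s (P j))))).
  by near=> y; rewrite mul1r.
apply: bar; first by rewrite expr1n.
apply: (@lt_trans _ _ (W2 (psi2 (height s (P j))))).
  by apply: (profile_W_decr prof2 tame2); rewrite mul1r; lra.
by rewrite psiK2 /height; lra.
Unshelve. all: end_near. Qed.

Lemma outer_lipschitz s t j (x : R) : `|outer s j x - outer t j x| <=
  ((kappa * rho + gmax) / gmin * (1 + k0 * chi)) * `|s - t|.
Proof.
have [[W10 _ _ dW1 _] _] := prof1.
have [kap0 rho0] := kr0; have [gm kk gge gle _] := tame1.
have hl := height_lipschitz s t (h_chi (P j)).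
have kr : 0 < kappa * rho by rewrite mulr_gt0.
have gx : 0 < gmax by apply: lt_le_trans (gle 0); exact: lt_le_trans (gge 0).
have inv (psi : R -> R) : (forall s t, `|psi s - psi t| <= gmin^-1 * `|s - t|) ->
    `|psi (height s (P j)) - psi (height t (P j))| <=
     gmin^-1 * ((1 + k0 * chi) * `|s - t|).
  by move=> plip; apply: le_trans (plip _ _) _; rewrite ler_wpM2l // invr_ge0 ltW.
have -> : (kappa * rho + gmax) / gmin * (1 + k0 * chi) * `|s - t| =
  (kappa * rho + gmax) * (gmin^-1 * ((1 + k0 * chi) * `|s - t|)) by ring.
rewrite /outer; case: eqP => [ji|_].
  apply: le_trans (bump_lipschitz rho0 kap0 W10 dW1
    (profile_slope_gt0 tame1) gle _ _) _.
  rewrite ler_wpM2l //; first by rewrite addr_ge0 // ltW.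
  have -> : x - center s - (x - center t) = - (psi1 (height s (P i)) - psi1 (height t (P i))).
    by rewrite /center; ring.
  by rewrite normrN -ji; apply: inv; exact: (profile_inv_lipschitz prof1 tame1).
apply: le_trans (profile_W_lipschitz prof2 tame2 _ _) _.
have -> : x + psi2 (height s (P j)) - (x + psi2 (height t (P j))) =
  psi2 (height s (P j)) - psi2 (height t (P j)) by ring.
apply: ler_pM => //; first exact: ltW; first by rewrite lerDr ltW.
by apply: inv; exact: (profile_inv_lipschitz prof2 tame2).
Qed.

Lemma outer_le0 s j : s <= (l + b) / 2 ->
  exists X, forall t x, s <= t -> t <= (l + b) / 2 -> X < x -> outer t j x <= 0.
Proof.
move=> sb; have [l0 lb] := l_itv; have [_ rho0] := kr0.
have [[W10 _ psiK1 dW1 _] _] := prof1; have [[_ _ psiK2 _ _] _] := prof2.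
have hb t : t <= (l + b) / 2 -> height t (P j) < b.
  by move=> tb; have [_] := near_height t (h_chi (P j)); rewrite /height; lra.
have [ji|nji] := eqVneq j i.
  have Y0 : 0 <= psi1 0.
    by rewrite -[leLHS](profile_inv_b prof1) (profile_inv_le prof1 tame1) //; lra.
  exists (2 * rho + psi1 (s - (b - l) / 4) + psi1 0) => t x st tb xX.
  rewrite /outer ji eqxx.
  have pc : psi1 (height t (P i)) <= psi1 (s - (b - l) / 4).
    apply: (profile_inv_le prof1 tame1).
    by have [+ _] := near_height t (h_chi (P i)); rewrite /height; lra.
  apply: bump1_le0.
  apply: le_trans (ler_norm _); rewrite /center; lra.
exists (psi2 0) => t x st tb xX; rewrite /outer (negbTE nji).
rewrite -[leRHS]psiK2; apply: (profile_W_nincr prof2 tame2).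
have : 0 <= psi2 (height t (P j)).
  by rewrite -(profile_inv_b prof2) (profile_inv_le prof2 tame2) // ltW // hb.
lra.
Qed.

(** As [s] tends to -oo, the barrier becomes nonpositive but for its bump, which
    moves off to infinity. *)
Lemma outer_start (X0 : R) : exists2 s, s <= 0 &
  (forall e x, edge_dom e x -> s + S s * potential h kD e x <= 0) /\
  forall j x, 0 <= x -> outer s j x <= 0 \/ (j = i /\ X0 <= x).
Proof.
have [l0 lb] := l_itv; have [_ rho0] := kr0.
have [[W10 _ psiK1 dW1 _] _] := prof1; have [[_ _ psiK2 _ _] _] := prof2.
have Y0 : 0 <= psi1 0.
  by rewrite -[leLHS](profile_inv_b prof1) (profile_inv_le prof1 tame1) //; lra.
have [M [M0 MW]] : exists M : R, M <= 0 /\ M <= W1 (psi1 0 + X0).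
  by exists (Num.min 0 (W1 (psi1 0 + X0))); rewrite !ge_min !lexx orbT.
have [s sE] : exists s : R, s + (b - l) / 4 = M by exists (M - (b - l) / 4); ring.
have hs (x : R) : `|x| <= chi -> s + S s * x <= M.
  by move=> /(near_height s)[_]; rewrite sE.
exists s; first by lra.
split=> [e x xe|j x x0]; first exact: le_trans (hs _ (pot_chi xe)) M0.
rewrite /outer; case: eqP => [ji|_]; last first.
  left; apply: (@le_trans _ _ (W2 (psi2 (height s (P j))))).
    by apply: (profile_W_nincr prof2 tame2); lra.
  by rewrite psiK2; exact: le_trans (hs _ (h_chi (P j))) M0.
have [xX|xX] := leP X0 x; [by right|left].
have [[_ WK1 _ _ _] _] := prof1.
have : psi1 0 + X0 <= psi1 (height s (P i)).
  rewrite -[leLHS]WK1; apply: (profile_inv_le prof1 tame1).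
  exact: le_trans (hs _ (h_chi (P i))) MW.
move=> cX.
apply: bump1_le0.
by rewrite distrC; apply: le_trans (ler_norm _); rewrite /center; lra.
Qed.

Lemma continuous_compose (p q : R -> R) : continuous p -> continuous q ->
  continuous (fun x => q (p x)).
Proof. by move=> cp cq x; exact: (continuous_comp (cp x) (cq (p x))). Qed.

(** The height [s] increases slowly up to [(l + b) / 2], where the barrier exceeds
    [l] on [D]; the bump stops when the vertex meets its rising side at about that
    height. *)
Lemma barrier_crossing (u : R -> graph_point G -> R) (T X0 : R) :
  entire_solution f u -> (forall t p, points G p -> 0 < u t p < 1) ->
  (forall x, 0 <= x -> X0 <= x -> m < u T (edge_point (inr i : edge G) x)) ->
  exists T', forall t, T' <= t ->
    (forall (e : edge D) x, edge_dom e x -> l < u t (edge_point (inl e : edge G) x)) /\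
    (forall j, l < u t (Vertex (P j : vertex G))).
Proof.
move=> sol u01 uT.
have upos d x t : edge_dom d x -> 0 < u t (edge_point d x).
  by move=> /edge_point_points/(u01 t)/andP[].
have [l0 lb] := l_itv; have [kap0 rho0] := kr0; have eta_gt0 := eta0.
have [f00 f0s] := f0_le.
have [gm kk gge gle _] := tame2.
have [n1 o0 s0 si0 [kd0 c0 b00 d0 [w1 oN]]] := crossing_constants.
have gx : 0 < gmax by apply: lt_le_trans (gle 0); exact: lt_le_trans (gge 0).
have [A [AE A0]] : exists A : R, 1 + k0 * chi = A /\ 0 < A.
  by exists (1 + k0 * chi); split; rewrite // addr_gt0 // mulr_gt0.
have [Q [QE Q0]] : exists Q : R, (kappa * rho + gmax) / gmin = Q /\ 0 < Q.
  by exists ((kappa * rho + gmax) / gmin); split; rewrite // divr_gt0 // addr_gt0 // mulr_gt0.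
(* Per unit of height, the barrier changes by [A] on [D] and by [Q * A] on the half
   lines at most; [eps] keeps its speed below [eta]. *)
have [eps [eps0 epsA epsQ]] : exists eps : R, [/\ 0 < eps, A * eps <= eta / 2 & Q * A * eps <= eta / 2].
  exists (eta / (2 * A * (1 + Q))).
  have den : 0 < 2 * A * (1 + Q) by rewrite !mulr_gt0 //; lra.
  split; first by rewrite divr_gt0.
    rewrite mulrA ler_pdivrMr //.
    have -> : eta / 2 * (2 * A * (1 + Q)) = A * eta + A * eta * Q by field.
    by rewrite lerDl !mulr_ge0 // ltW.
  rewrite mulrA ler_pdivrMr //.
  have -> : eta / 2 * (2 * A * (1 + Q)) = Q * A * eta + A * eta by field.
  by rewrite lerDl !mulr_ge0 // ltW.
have [sl [sl0 [startD startO]]] : exists sl, sl <= 0 /\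
    ((forall e x, edge_dom e x -> sl + S sl * potential h kD e x <= 0) /\
    forall j x, 0 <= x -> outer sl j x <= 0 \/ (j = i /\ X0 <= x)).
  by have [sl ? ?] := outer_start X0; exists sl.
have lohi : sl <= (l + b) / 2 by lra.
pose theta := ramp sl ((l + b) / 2) eps T.
have theta_le t : theta t <= (l + b) / 2 := ramp_le _ _ _ _ _.
have ctheta : continuous theta := @ramp_continuous _ _ _ _ _ (ltW eps0).
have theta_lip s t : `|theta t - theta s| <= eps * `|t - s|.
  by apply: ramp_lipschitz; exact: ltW.
have cheight v : continuous (fun s => height s v).
  apply: (@lipschitz_continuous _ _ A) => s t; rewrite -AE.
  exact: (height_lipschitz s t (h_chi v)).
have cS : continuous S.
  apply: (@lipschitz_continuous _ _ k0) => s t; rewrite /S opprD addrACA subrr addr0.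
  by have [_ _ _ _ H] := tame2; exact: H.
have cpsi1 := profile_inv_continuous prof1 tame1.
have cpsi2 := profile_inv_continuous prof2 tame2.
have cheight_theta v : continuous (fun t => height (theta t) v) := continuous_compose ctheta (cheight v).
pose Z (j : 'I_N) (t x : R) : R := outer (theta t) j x.
pose z : edge G -> R -> R -> R := attached_barrier theta (fun t => S (theta t)) h kD Z.
have main : forall t e x, T <= t -> edge_dom e x -> z e t x < u t (edge_point e x).
  apply: (@attached_comparison _ _ _ P bounded_D f u T eta (eta / 2) theta
    (fun t => S (theta t)) h kD bv Z
    (fun j t => if j == i then g1 (height (theta t) (P j)) else - g2 (height (theta t) (P j)))
    sol u01 h_flux ctheta) => //.
  - exact: continuous_compose.
  - move=> j; rewrite /Z /outer; case: (j == i).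
      apply: (@continuous_translation _ (bump W1 b kappa rho) (fun t => - center (theta t))).
        have [[W10 _ _ dW1 _] _] := prof1; have [_ _ _ gle1 _] := tame1.
        exact: (bump_continuous rho0 kap0 W10 dW1 (profile_slope_gt0 tame1) gle1).
      move=> t; apply: cvgN; apply: cvgD; first exact: cvg_cst.
      exact: (continuous_compose (cheight_theta (P i)) cpsi1).
    apply: (@continuous_translation _ W2 (fun t => psi2 (height (theta t) (P j)))).
      exact: (profile_W_continuous prof2 tame2).
    exact: (continuous_compose (cheight_theta (P j)) cpsi2).
  - move=> j t1; have [X HX] := outer_le0 j lohi; exists X => t x Tt _ xX.
    by apply: HX => //; apply: ramp_ge => //; exact: ltW.
  - move=> e x xe; rewrite /z /attached_barrier /theta ramp_start //.
    case: e xe => [e|j] xe; first by apply: le_lt_trans (upos _ _ _ xe); exact: startD.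
    rewrite /Z /theta ramp_start //; have [x0 _] := xe.
    have [out|[ji xX]] := startO j x x0; first exact: le_lt_trans (upos _ _ _ xe).
    subst j; apply: le_lt_trans (uT x x0 xX); apply: le_trans top_le.
    have [[W10 _ _ dW1 _] _] := prof1.
    rewrite /outer eqxx; exact: (bump_le_top rho kap0 W10 dW1 (profile_slope_gt0 tame1)).
  - by move=> j t; exact: outer_vertex.
  - by move=> j t _; exact: is_derive_outer0.
  - by move=> v t _; exact: crossing_flux.
  - lra.
  - move=> e x s t xe st.
    have tl := theta_lip s t; rewrite (gtr0_norm (_ : 0 < t - s)) ?subr_gt0 // in tl.
    have ts0 : 0 <= t - s by lra.
    suff : attached_barrier theta (fun t => S (theta t)) h kD Z e t x -
        attached_barrier theta (fun t => S (theta t)) h kD Z e s x <= eta / 2 * (t - s) by lra.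
    apply: le_trans (ler_norm _) _.
    case: e xe => [e|j] xe; rewrite /attached_barrier.
      apply: le_trans (height_lipschitz (theta t) (theta s) (pot_chi xe)) _; rewrite AE.
      apply: (@le_trans _ _ (A * (eps * (t - s)))); first by rewrite ler_wpM2l // ltW.
      by rewrite mulrA ler_wpM2r.
    apply: le_trans (outer_lipschitz (theta t) (theta s) j x) _; rewrite AE QE.
    apply: (@le_trans _ _ (Q * A * (eps * (t - s)))).
      by rewrite ler_wpM2l // mulr_ge0 // ltW.
    by rewrite mulrA ler_wpM2r.
  - move=> e t x Tt xe eq.
    have xe' : edge_dom (inl e : edge G) x by [].
    have /(u01 t) := edge_point_points xe'; rewrite eq => /andP[z0 z1].
    have := f0s _ (ltW z0) (ltW z1).
    have [Sge _] := S_bounds (theta t).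
    have : gmin * kD <= S (theta t) * kD by rewrite ler_wpM2r // ltW.
    have -> : gmin * kD = f0 + eta by rewrite /kD mulrC divfK // gt_eqF.
    by lra.
  - by move=> j t x Tt x0 _; apply: outer_barrier.
exists (T + ((l + b) / 2 - sl) / eps) => t Tt.
have Tt' : T <= t.
  by apply: le_trans Tt; rewrite lerDl divr_ge0 ?(ltW eps0) //; lra.
have thetaE : theta t = (l + b) / 2 by exact: ramp_end.
split=> [e x xe|j].
  have := main t (inl e) x Tt' xe; rewrite /z /attached_barrier thetaE.
  by have [+ _] := near_height ((l + b) / 2) (pot_chi xe); lra.
have := main t (inr j) 0 Tt' (edge_dom0 _).
rewrite /z /attached_barrier /Z outer_vertex // /edge_point eqxx thetaE.
by have [+ _] := near_height ((l + b) / 2) (h_chi (P j)); rewrite /height /=; lra.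
Qed.

End Graph.

Lemma crossing : exists2 del : R, 0 < del &
  forall (D : metric_graph R) (P : 'I_N -> vertex D) (i : 'I_N),
  bounded_graph D -> \sum_(e : edge D) fine (len e) < del ->
  forall (u : R -> graph_point (attach P) -> R) (T X0 : R),
  entire_solution f u -> (forall t p, points (attach P) p -> 0 < u t p < 1) ->
  (forall x, 0 <= x -> X0 <= x -> m < u T (edge_point (inr i : edge (attach P)) x)) ->
  exists T', forall t, T' <= t ->
    (forall (e : edge D) x, edge_dom e x ->
       l < u t (edge_point (inl e : edge (attach P)) x)) /\
    (forall j, l < u t (Vertex (P j : vertex (attach P)))).
Proof.
have [n1 o0 s0 si0 [kd0 c0 b00 d0 [w1 oN]]] := crossing_constants.
exists delta => // D P i bD small u T X0.
have [h [flux hc pc]] := crossing_potential P i bD small.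
exact: (barrier_crossing bD small flux hc pc).
Qed.

End Crossing.

(** * Complete invasion *)

Section Assembly.
Context {R : realType}.

Lemma tame_common (g1 g2 : R -> R) :
  (exists gmin gmax k, tame_slope g1 gmin gmax k) ->
  (exists gmin gmax k, tame_slope g2 gmin gmax k) ->
  exists gmin gmax k, tame_slope g1 gmin gmax k /\ tame_slope g2 gmin gmax k.
Proof.
have weaken (g : R -> R) c1 c2 c3 d1 d2 d3 : 0 < d1 -> d1 <= c1 -> c2 <= d2 -> c3 <= d3 ->
    tame_slope g c1 c2 c3 -> tame_slope g d1 d2 d3.
  move=> d10 dc1 cd2 cd3 [c10 c30 gge gle glip]; split=> //.
  - exact: lt_le_trans cd3.
  - by move=> s; exact: le_trans (gge s).
  - by move=> s; exact: le_trans cd2.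
  - by move=> s t; apply: le_trans (glip s t) _; rewrite ler_wpM2r.
move=> [a1 [b1 [c1 t1]]] [a2 [b2 [c2 t2]]].
have [a10 _ _ _ _] := t1; have [a20 _ _ _ _] := t2.
exists (Num.min a1 a2), (Num.max b1 b2), (Num.max c1 c2).
have m0 : 0 < Num.min a1 a2 by rewrite lt_min a10.
split; [apply: weaken t1|apply: weaken t2];
  by rewrite ?ge_min ?le_max ?lexx ?orbT.
Qed.

Lemma total_length_fine (D : metric_graph R) (delta : R) : bounded_graph D ->
  (total_length D < delta%:E)%E -> \sum_(e : edge D) fine (len e) < delta.
Proof.
move=> bD; rewrite /total_length.
have -> : (\sum_(e : edge D) len e = (\sum_(e : edge D) fine (len e))%:E)%E.
  by rewrite -sumEFin; apply: eq_bigr => e _; rewrite fineK // bD.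
by rewrite lte_fin.
Qed.

(** As [D] is connected, a vertex of [D] without edges in [D] is [P i]. *)
Lemma points_on_edges (D : metric_graph R) (N : nat) (P : 'I_N -> vertex D) (i : 'I_N)
    (p : graph_point (attach P)) : bounded_graph D -> points _ p ->
  exists e x, edge_dom e x /\ edge_point e x = p.
Proof.
move=> bD; case: p => [v _|e x [x0 xl]]; last first.
  exists e, x; split; first by split; apply: ltW.
  by rewrite /edge_point gt_eqF // lt_eqF.
have /connectP[[|w q] /=] := graph_connected (v : vertex D) (P i).
  move=> _ <-; exists (inr i), 0; split; first exact: edge_dom0.
  by rewrite /edge_point eqxx.
move=> /andP[/existsP[e /andP[le /orP[/andP[/eqP sv _]|/andP[_ /eqP tv]]]] _ _].
  exists (inl e), 0; split; first exact: edge_dom0.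
  by rewrite /edge_point eqxx /= sv.
exists (inl e : edge (attach P)), (fine (len e)); split.
  exact: (@edge_dom_end _ (attach P) (inl e)).
by rewrite (@edge_point_end _ (attach P) (inl e)) //= tv.
Qed.

(** At a very negative time [u] is uniformly close to the traveling wave, whose
    limit at -oo is [1]. *)
Lemma front_like_start (f phi : R -> R) (a c m : R) (D : metric_graph R) (N : nat)
    (P : 'I_N -> vertex D) (i : 'I_N) (u : R -> graph_point (attach P) -> R) :
  (2 <= N)%N -> m < 1 -> traveling_wave f a phi c -> front_like f phi c i u ->
  exists T X, forall x, 0 <= x -> X <= x ->
    m < u T (edge_point (inr i : edge (attach P)) x).
Proof.
move=> N2 m1 [c0 _ phi01 [phi1 _] _] [_ u01 past].
pose e := (1 - m) / 2; have e0 : 0 < e by rewrite /e; lra.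
have dom j x : 0 <= x -> edge_dom (inr j : edge (attach P)) x.
  by move=> x0; split; rewrite ?leey.
pose A t := [set `|u t (edge_point (outer_edge P i) x) - phi (- x - c * t)| |
  x in [set x : R | 0 <= x]].
pose B t := [set `|u t p| | p in points (attach P) `\` outer_path P i].
have supA t : has_sup (A t).
  split; first by exists `|u t (edge_point (outer_edge P i) 0) - phi (- 0 - c * t)|, 0 => /=.
  exists 1 => y [x /= x0 <-].
  have /andP[h1 h2] := u01 t _ (edge_point_points (dom i x x0)).
  have /andP[h3 h4] := phi01 (- x - c * t).
  by rewrite ler_norml; apply/andP; split; rewrite /outer_edge; lra.
have B0 t : 0 <= sup (B t).
  have [j ji] : exists j : 'I_N, j != i.
    have N1 : (1 < N)%N by [].
    have N0 : (0 < N)%N by exact: ltn_trans N1.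
    have [->|] := eqVneq i (Ordinal N0); first by exists (Ordinal N1).
    by rewrite eq_sym => ?; exists (Ordinal N0).
  have ptj : edge_point (inr j : edge (attach P)) 1 = OnEdge (inr j : edge (attach P)) 1.
    by rewrite /edge_point oner_eq0.
  have ptB : (points (attach P) `\` outer_path P i) (OnEdge (inr j : edge (attach P)) 1).
    split; first by rewrite /= ltr01 ltry.
    move=> [x /= x0]; rewrite /edge_point; case: ifP => // _ [jE _].
    by rewrite jE eqxx in ji.
  apply: (@le_trans _ _ `|u t (OnEdge (inr j : edge (attach P)) 1)|) => //.
  apply: ub_le_sup; last by exists (OnEdge (inr j : edge (attach P)) 1).
  exists 1 => y [p [pp _] <-]; have /andP[h1 h2] := u01 t p pp.
  by rewrite gtr0_norm // ltW.
have [T HT] : exists T, sup (A T) < e.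
  have /cvgr_lt/(_ e e0) := past.
  move=> [M [_ HM]]; exists (M - 1); have := HM (M - 1) ltac:(lra).
  by have := B0 (M - 1); rewrite /A /B; lra.
have [Z HZ] : exists Z, forall y, y < Z -> 1 - e < phi y.
  have /cvgr_gt/(_ (1 - e) ltac:(lra)) := phi1.
  by move=> [M [_ HM]]; exists M => y; exact: HM.
exists T, (1 - Z - c * T) => x x0 xX.
have := HZ (- x - c * T) ltac:(lra).
have : `|u T (edge_point (inr i : edge (attach P)) x) - phi (- x - c * T)| < e.
  apply: le_lt_trans HT; apply: ub_le_sup; first by have [] := supA T.
  by exists x.
by rewrite ltr_norml /e => /andP[? ?]; lra.
Qed.

End Assembly.

Theorem theorem2p28 (R : realType) (f : R -> R) (a : R) (phi : R -> R) (c : R)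
    (N : nat) (f_bistable : bistable f a)
    (phi_wave : traveling_wave f a phi c) (N_ge2 : (2 <= N)%N)
    (F_cond : 0 < primitive f 1 + ((N%:R - 1) ^+ 2 - 1) * primitive f a) :
  exists2 delta : R, 0 < delta &
    forall (D : metric_graph R) (P : 'I_N -> vertex D),
      bounded_graph D -> (total_length D < delta%:E)%E ->
      forall i : 'I_N, complete_invasion f phi c P i.
Proof.
have bi := f_bistable.
have [a0 a1 fn fp] := bistable_nodes bi.
pose n : R := N%:R - 1.
have n1 : 1 <= n by have : 2 <= N%:R :> R; [rewrite ler_nat|rewrite /n; lra].
have nn1 : 1 <= n ^+ 2 by rewrite expr_ge1 //; lra.
have Fa0 : primitive f a <= 0 by apply: (energy_le0 bi); lra.
have [b [ab b1 Fb]] := energy_near_left bi a1 F_cond.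
have Fb0 : 0 < primitive f b.
  have : (n ^+ 2 - 1) * primitive f a <= 0 by rewrite mulr_ge0_le0 // subr_ge0.
  by rewrite /n; lra.
(* A second, lower bump, which fits below the level reached by the first. *)
have [b2 [ab2 b2b Fb2]] : exists x, [/\ a < x, x < b & 0 < primitive f x + 0].
  by apply: (energy_near_left bi ab); rewrite addr0.
rewrite addr0 in Fb2.
pose l := (b2 + b) / 2; pose m := (b + 1) / 2.
have b2l : b2 < l by rewrite /l; lra.
have lb : l < b by rewrite /l; lra.
have l1 : l < 1 by lra.
have bm : b < m by rewrite /m; lra.
have m1 : m < 1 by rewrite /m; lra.
have l0 : 0 < l by lra.
have [eta2 eta20 /(_ _ eta20 (lexx _))] := rising_profile bi ab2 b2l l1 Fb2 (lexx 2).
set g3 := slope _ _ => -[[gmin3 [gmax3 [k3 tame3]]] [W3 [psi3 [kappa3 [rho3]]]]].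
move=> [prof3 kappa30 rho30 top3 bump3].
have C2 : 2 <= 3 * n ^+ 2 by lra.
have [eta eta0 /(_ _ eta0 (lexx _))] := rising_profile bi ab bm m1 Fb0 C2.
set g1 := slope _ _ => -[tame1 [W1 [psi1 [kappa [rho]]]]].
move=> [prof1 kappa0 rho0 top1 bump1].
have [tame2 [W2 [psi2 prof2]]] := descending_profile bi n1 ab b1 Fb eta0.
have [mu mu0 gap] := slope_gap bi n1 ab b1 Fb eta0.
have [gmin [gmax [k [{}tame1 {}tame2]]]] := tame_common tame1 tame2.
have [f0 f00 f0_le] : exists2 f0, 0 <= f0 & forall s : R, 0 <= s -> s <= 1 -> - f0 <= f s.
  have cf : {within `[0, 1], continuous f}.
    by apply: continuous_subspaceT; exact: (bistable_continuous bi).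
  have [x _ Hx] := EVT_min ler01 cf.
  exists `|f x| => // s s0 s1; apply: (@le_trans _ _ (f x)).
    by rewrite lerNl -normrN ler_norm.
  by apply: Hx; rewrite in_itv /=; apply/andP.
have [delta delta0 cross] := crossing N_ge2 (conj l0 lb) eta0 (conj kappa0 rho0)
  mu0 top1 (conj f00 f0_le) prof1 prof2 tame1 tame2 bump1 gap.
exists delta => // D P bD small i u fu.
have [sol u01 _] := fu.
have {}small := total_length_fine bD small.
have [T0 [X0 start]] := front_like_start N_ge2 m1 phi_wave fu.
have [T1 HT1] := cross D P i bD small u T0 X0 sol u01 start.
have [[W30 _ psiK3 dW3 _] _] := prof3.
have [gmin30 _ gge3 gle3 _] := tame3.
have g30 := profile_slope_gt0 tame3.
have b20 : 0 < b2 by lra.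
have Y0 : 0 <= psi3 0.
  by rewrite -[leLHS](profile_inv_b prof3) (profile_inv_le prof3 tame3) // ltW.
have K0 : 0 < kappa3 * rho3 + gmax3.
  by rewrite addr_gt0 ?mulr_gt0 //; exact: lt_le_trans (g30 0) (gle3 0).
have spread X : exists T, forall t, T <= t ->
     (forall (e : edge D) x, edge_dom e x -> b2 < u t (edge_point (inl e : edge (attach P)) x)) /\
     (forall j x, 0 <= x -> x <= X -> b2 < u t (edge_point (inr j : edge (attach P)) x)).
  have sweep (j : 'I_N) : exists T', forall t x, T' <= t -> 0 <= x -> x <= X ->
      bump W3 b2 kappa3 rho3 0 < u t (edge_point (inr j : edge (attach P)) x).
    apply: (@bump_sweep _ (attach P) f u (inr j) (bump W3 b2 kappa3 rho3) eta2
      (kappa3 * rho3 + gmax3) (rho3 + psi3 0) l T1 X sol u01) => //.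
    - by rewrite addr_ge0 // ltW.
    - exact: (bump_lipschitz rho30 kappa30 W30 dW3 g30 gle3).
    - by move=> y; apply: le_trans top3; exact: (bump_le_top rho3 kappa30 W30 dW3 g30).
    - move=> y yY; apply: (bump_le0 kappa3 rho30 W30 dW3 g30 (Y := psi3 0)) => //.
      by rewrite psiK3.
    - by move=> t Tt; have [_ H] := HT1 t Tt; exact: H.
  have [T' HT'] := choice sweep.
  exists (`|T1| + \sum_j `|T' j|) => t Tt.
  have S0 : 0 <= \sum_j `|T' j| by rewrite sumr_ge0.
  have T1t : T1 <= t by have := ler_norm T1; lra.
  split=> [e x xe|j x x0 xX].
    by have [H _] := HT1 t T1t; apply: lt_trans b2l _; exact: H.
  have T'j : T' j <= t.
    have : `|T' j| <= \sum_j `|T' j| by rewrite (bigD1 j) //= lerDl sumr_ge0.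
    by have := ler_norm (T' j); have := normr_ge0 T1; lra.
  apply: lt_trans (HT' j t x T'j x0 xX); rewrite (bump0 W3 b2 kappa3 rho30).
  by rewrite /bump_top ltrDl mulr_gt0 ?divr_gt0 // exprn_gt0.
have b21 : b2 < 1 by lra.
move=> p pp; have [d [x [dx <-]]] := points_on_edges i bD pp.
apply/cvgrPdist_lt => e e0.
pose e' := Num.min e ((1 - b2) / 2).
have e'0 : 0 < e' by rewrite lt_min e0 divr_gt0 // subr_gt0.
have e'e : e' <= e by rewrite ge_min lexx.
have e'b : b2 < 1 - e'.
  have : e' <= (1 - b2) / 2 by rewrite ge_min lexx orbT.
  by lra.
have X0' : 0 <= `|x| by [].
have [T HT] := fill bD i bi ab2 b21 sol u01 spread e'0 e'b X0'.
exists T; split; first exact: num_real.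
move=> t /ltW Tt; have /andP[_ u1] := u01 t _ (edge_point_points dx).
have [HD HO] := HT t Tt.
rewrite gtr0_norm ?subr_gt0 //.
suff : 1 - e' < u t (edge_point d x) by lra.
case: d dx u1 => [d|j] dx u1; first exact: HD.
by apply: HO; [case: dx|exact: ler_norm].
Qed.
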